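(* Assume (A1)–(A3). Let $\alpha^*\in I$ and $s\geq0$. Take an arbitrary $\alpha_s\in(\underline{\alpha},\alpha^* )$ and set $T:=T(\alpha_s,\alpha^* )$. Then for any $u_s\in B_{\alpha_s}$ there exists a function $u:[s,s+T)\to B_{\alpha^*}$ such that: (1) $u$ is continuous on $[s,s+T)$ and continuously differentiable on $(s,s+T)$ (as a $B_{\alpha^*}$-valued function); (2) for every $t\in(s,s+T)$, $Au(t)\in B_{\alpha^*}$ and $Zu(t)\in B_{\alpha^*}$; (3) $\frac{d}{dt}u(t)=Au(t)+Zu(t)$ in $B_{\alpha^*}$ for all $t\in(s,s+T)$; (4) $u(s)=u_s$.
   Context: Standing assumptions (A1)–(A3): (A1) Fix $\underline{\alpha}>0$, $\overline{\alpha}\in(0,\infty]$ and set $I=(\underline{\alpha},\overline{\alpha})$. $(B_\alpha,\lVert\cdot\rVert_\alpha)_{\alpha\in I}$ is a family of Banach spaces such that for $\alpha'\le\alpha''$ in $I$: $B_{\alpha'}\subset B_{\alpha''}$ and $\lVert u\rVert_{\alpha'}\ge\lVert u\rVert_{\alpha''}$ for $u\in B_{\alpha'}$; moreover, if $u\in B_{\alpha'}$ and $u=0$ in $B_{\alpha''}$ then $u=0$ in $B_{\alpha'}$. Put $B_I:=\bigcup_{\alpha\in I}B_\alpha$. (A2) For each $\alpha\in I$ there are a closed linear subspace $C_\alpha\subset B_\alpha$ and a dense (in $C_\alpha$) linear subspace $D_\alpha\subset C_\alpha$. $A:B_I\to B_I$ is linear and, for each $\alpha\in I$, $(A,D_\alpha)$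 is the generator of a $C_0$-semigroup $S_\alpha(t)$ on $(C_\alpha,\lVert\cdot\rVert_\alpha)$. For all $\alpha'<\alpha$ in $I$: $B_{\alpha'}\subset D_\alpha$, $B_{\alpha'}$ is $S_\alpha(t)$-invariant, and $S_\alpha(t)\restriction_{B_{\alpha'}}=S_{\alpha'}(t)$. There are constants $\nu\ge1$, $\omega\in\mathbb{R}$, independent of $\alpha$, with $\lVert S_\alpha(t)\rVert\le\nu e^{\omega t}$ for all $t\ge0$, $\alpha\in I$. (A3) $M,N:I\to(0,\infty)$ are increasing continuous functions, and $Z:B_I\to B_I$ is linear such that for any $\alpha^*\in I$ and any $\alpha',\alpha''\in(\underline{\alpha},\alpha^*]$ with $\alpha'<\alpha''$, $Z$ maps $B_{\alpha'}$ boundedly into $B_{\alpha''}$ with $\lVert Zu\rVert_{\alpha''}\le\bigl(\frac{M(\alpha^* )}{\alpha''-\alpha'}+N(\alpha^* )\bigr)\lVert u\rVert_{\alpha'}$ for $u\in B_{\alpha'}$. Define $T(\alpha,\beta):=\dfrac{\beta-\alpha}{e\,\nu\,M(\beta)}$ for $\beta\ge\alpha>\underline{\alpha}$. *)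

(* Defs.v *)
From Stdlib Require Import Reals Lra.
Open Scope R_scope.

(* A real vector space (the common carrier in which all B_alpha live). *)
Record VSpace := {
  vcar :> Type;
  vzero : vcar;
  vadd : vcar -> vcar -> vcar;
  vopp : vcar -> vcar;
  vscal : R -> vcar -> vcar;
  vaddA : forall x y z, vadd x (vadd y z) = vadd (vadd x y) z;
  vaddC : forall x y, vadd x y = vadd y x;
  vadd0 : forall x, vadd x vzero = x;
  vaddN : forall x, vadd x (vopp x) = vzero;
  vscal1 : forall x, vscal 1 x = x;
  vscalA : forall a b x, vscal a (vscal b x) = vscal (a * b) x;
  vscalDr : forall a x y, vscal a (vadd x y) = vadd (vscal a x) (vscal a y);
  vscalDl : forall a b x, vscal (a + b) x = vadd (vscal a x) (vscal b x)
}.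

Arguments vzero {v}.
Arguments vadd {v}.
Arguments vopp {v}.
Arguments vscal {v}.

Definition vsub {V : VSpace} (x y : V) : V := vadd x (vopp y).

Definition is_subspace {V : VSpace} (P : V -> Prop) : Prop :=
  P vzero /\ (forall x y, P x -> P y -> P (vadd x y)) /\
  (forall a x, P x -> P (vscal a x)).

Definition is_norm_on {V : VSpace} (P : V -> Prop) (n : V -> R) : Prop :=
  (forall x, P x -> 0 <= n x) /\
  (forall x, P x -> n x = 0 -> x = vzero) /\
  (forall a x, P x -> n (vscal a x) = Rabs a * n x) /\
  (forall x y, P x -> P y -> n (vadd x y) <= n x + n y).

Definition seq_cauchy {V : VSpace} (n : V -> R) (f : nat -> V) : Prop :=
  forall eps, 0 < eps -> exists N : nat, forall p q : nat,
    (N <= p)%nat -> (N <= q)%nat -> n (vsub (f p) (f q)) < eps.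

Definition seq_conv {V : VSpace} (n : V -> R) (f : nat -> V) (l : V) : Prop :=
  forall eps, 0 < eps -> exists N : nat, forall k : nat,
    (N <= k)%nat -> n (vsub (f k) l) < eps.

Definition is_banach {V : VSpace} (P : V -> Prop) (n : V -> R) : Prop :=
  is_subspace P /\ is_norm_on P n /\
  (forall f : nat -> V, (forall k, P (f k)) -> seq_cauchy n f ->
     exists l, P l /\ seq_conv n f l).

Definition closed_subspace {V : VSpace} (B : V -> Prop) (n : V -> R)
  (C : V -> Prop) : Prop :=
  is_subspace C /\ (forall x, C x -> B x) /\
  (forall (f : nat -> V) (l : V), (forall k, C (f k)) -> B l ->
     seq_conv n f l -> C l).

Definition dense_subspace {V : VSpace} (n : V -> R) (C D : V -> Prop) : Prop :=
  is_subspace D /\ (forall x, D x -> C x) /\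
  (forall x, C x -> forall eps, 0 < eps -> exists d, D d /\ n (vsub x d) < eps).

Definition lim_0plus {V : VSpace} (n : V -> R) (g : R -> V) (y : V) : Prop :=
  forall eps, 0 < eps -> exists delta, 0 < delta /\
    forall h, 0 < h < delta -> n (vsub (g h) y) < eps.

Definition C0_semigroup {V : VSpace} (C : V -> Prop) (n : V -> R)
  (St : R -> V -> V) : Prop :=
  (forall t x, 0 <= t -> C x -> C (St t x)) /\
  (forall t x y, 0 <= t -> C x -> C y -> St t (vadd x y) = vadd (St t x) (St t y)) /\
  (forall t a x, 0 <= t -> C x -> St t (vscal a x) = vscal a (St t x)) /\
  (forall t, 0 <= t -> exists K, forall x, C x -> n (St t x) <= K * n x) /\
  (forall x, C x -> St 0 x = x) /\
  (forall t r x, 0 <= t -> 0 <= r -> C x -> St (t + r) x = St t (St r x)) /\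
  (forall x, C x -> lim_0plus n (fun h => St h x) x).

Definition is_generator {V : VSpace} (C D : V -> Prop) (n : V -> R)
  (St : R -> V -> V) (Aop : V -> V) : Prop :=
  (forall x, C x -> (D x <-> exists y, C y /\
       lim_0plus n (fun h => vscal (/ h) (vsub (St h x) x)) y)) /\
  (forall x, D x -> C (Aop x) /\
       lim_0plus n (fun h => vscal (/ h) (vsub (St h x) x)) (Aop x)).

Definition inI (alo : R) (ahi : option R) (a : R) : Prop :=
  alo < a /\ match ahi with None => True | Some h => a < h end.

Definition BI {V : VSpace} (alo : R) (ahi : option R) (B : R -> V -> Prop)
  (x : V) : Prop := exists a, inI alo ahi a /\ B a x.

Definition linear_on {V : VSpace} (P : V -> Prop) (f : V -> V) : Prop :=
  (forall x y, P x -> P y -> f (vadd x y) = vadd (f x) (f y)) /\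
  (forall c x, P x -> f (vscal c x) = vscal c (f x)).

Definition StdA1 {V : VSpace} (alo : R) (ahi : option R) (B : R -> V -> Prop)
  (nrm : R -> V -> R) : Prop :=
  0 < alo /\ (match ahi with None => True | Some h => 0 < h end) /\
  (forall a, inI alo ahi a -> is_banach (B a) (nrm a)) /\
  (forall a1 a2, inI alo ahi a1 -> inI alo ahi a2 -> a1 <= a2 ->
     (forall x, B a1 x -> B a2 x) /\ (forall x, B a1 x -> nrm a2 x <= nrm a1 x)).

Definition StdA2 {V : VSpace} (alo : R) (ahi : option R) (B : R -> V -> Prop)
  (nrm : R -> V -> R) (C D : R -> V -> Prop) (Aop : V -> V)
  (S : R -> R -> V -> V) (nu omega : R) : Prop :=
  (forall a, inI alo ahi a ->
     closed_subspace (B a) (nrm a) (C a) /\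
     dense_subspace (nrm a) (C a) (D a) /\
     C0_semigroup (C a) (nrm a) (S a) /\
     is_generator (C a) (D a) (nrm a) (S a) Aop) /\
  linear_on (BI alo ahi B) Aop /\
  (forall x, BI alo ahi B x -> BI alo ahi B (Aop x)) /\
  (forall a' a, inI alo ahi a' -> inI alo ahi a -> a' < a ->
     (forall x, B a' x -> D a x) /\
     (forall t x, 0 <= t -> B a' x -> B a' (S a t x)) /\
     (forall t x, 0 <= t -> B a' x -> S a t x = S a' t x)) /\
  1 <= nu /\
  (forall a t x, inI alo ahi a -> 0 <= t -> C a x ->
     nrm a (S a t x) <= nu * exp (omega * t) * nrm a x).

Definition StdA3 {V : VSpace} (alo : R) (ahi : option R) (B : R -> V -> Prop)
  (nrm : R -> V -> R) (M N : R -> R) (Z : V -> V) : Prop :=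
  (forall a, inI alo ahi a -> 0 < M a /\ 0 < N a /\
     continuity_pt M a /\ continuity_pt N a) /\
  (forall a b, inI alo ahi a -> inI alo ahi b -> a <= b -> M a <= M b /\ N a <= N b) /\
  linear_on (BI alo ahi B) Z /\
  (forall x, BI alo ahi B x -> BI alo ahi B (Z x)) /\
  (forall astar a' a'', inI alo ahi astar -> alo < a' -> a' < a'' -> a'' <= astar ->
     forall u, B a' u -> B a'' (Z u) /\
       nrm a'' (Z u) <= (M astar / (a'' - a') + N astar) * nrm a' u).

Definition Tdef (nu : R) (M : R -> R) (a b : R) : R :=
  (b - a) / (exp 1 * nu * M b).

Definition cont_on {V : VSpace} (n : V -> R) (dom : R -> Prop) (u : R -> V) : Prop :=
  forall t0, dom t0 -> forall eps, 0 < eps -> exists delta, 0 < delta /\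
    forall t, dom t -> Rabs (t - t0) < delta -> n (vsub (u t) (u t0)) < eps.

Definition has_deriv_at {V : VSpace} (n : V -> R) (u : R -> V) (t : R) (du : V) : Prop :=
  forall eps, 0 < eps -> exists delta, 0 < delta /\
    forall h, h <> 0 -> Rabs h < delta ->
      n (vsub (vscal (/ h) (vsub (u (t + h)) (u t))) du) < eps.

(* Main.v *)
(* The solution is the limit of the Picard iterates of
   [u t = S t us + int_0^t S (t - r) (Z (u r)) dr].  The difference of two
   consecutive iterates is estimated in the norm of [B b] by letting each of the
   [k] applications of [Z] lose [(b - als) / (k + 1)] of the scale; this gives a
   term of the order of [(e nu M t / (b - als)) ^ k], and a given [t] below the
   lifetime makes it geometric once [b] is close enough to [astar].  Since an
   element of [B a] lies in the domain of the generator on every larger space,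
   the uniform boundedness principle makes [S] Lipschitz, and [A] bounded, from
   [B a] to [B b] for [a < b].  Hence the iterates are locally Lipschitz, and
   the one-step estimate [u (t + h) = S h (u t) + h Z (u t) + o(h)], uniform in
   [t], shows that [u] is continuously differentiable. *)

(* Each operator is tame only after a loss of scale: [Z] and [A] may lead out of [B a], and [S] is
   strongly continuous on [C b], which contains [B a] for [a < b] but is not assumed to contain
   [B b]. Functions are therefore controlled in all [B b] with [als < b < astar] at once, and a
   qualitative statement may spend any part of a gap. Only the [Z] in the iterates have to be
   counted. There [S] costs no scale but a factor [nu], and [k] gaps of size about [(b - als) / k]
   combine with the [k!] of the iterated integrals to [k ^ k / k!], of order [e ^ k]: hence the
   [e nu] in the lifetime. The Duhamel integral is never differentiated under the integral sign.
   Splitting it at [t] by the semigroup law gives the one-step formula for each iterate, and the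
   limit is taken in the resulting inequality. Uniformity in [t] matters because [S] runs forward
   only: the left difference quotient at [t0] is a forward step that starts before [t0]. *)
Require Import Defs.
From Stdlib Require Import Reals Factorial Lra Lia List.
From Stdlib Require Import ClassicalEpsilon.
From Stdlib Require Import FunctionalExtensionality PropExtensionality.
From Coquelicot Require Import Coquelicot.
Open Scope R_scope.

(** * Linear identities in a vector space *)

Section VectorIdentities.
Variable V : VSpace.

Lemma vscal0 (x : V) : vscal 0 x = vzero.
Proof.
  rewrite <- (vaddN _ (vscal 0 x)).
  assert (H : vscal 0 x = vadd (vscal 0 x) (vscal 0 x)).
  { rewrite <- vscalDl. f_equal. ring. }
  transitivity (vadd (vadd (vscal 0 x) (vscal 0 x)) (vopp (vscal 0 x))).
  - now rewrite <- vaddA, vaddN, vadd0.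
  - now rewrite <- H.
Qed.

Lemma vopp_scal (x : V) : vopp x = vscal (-1) x.
Proof.
  rewrite <- (vadd0 _ (vopp x)), <- (vscal0 x).
  replace 0 with (1 + -1) by ring.
  now rewrite vscalDl, vscal1, vaddA, (vaddC _ (vopp x)), vaddN, vaddC, vadd0.
Qed.

Lemma vscal_zero (a : R) : vscal a (vzero : V) = vzero.
Proof.
  rewrite <- (vscal0 vzero), vscalA, Rmult_0_r. reflexivity.
Qed.

(** Syntax for proof by reflection: two linear combinations of the same atoms are equal once their
    real coefficients are. *)
Inductive vexpr :=
  | EZero | EAtom (i : nat) | EAdd (e f : vexpr) | EOpp (e : vexpr)
  | EScal (a : R) (e : vexpr).

Fixpoint vden (env : list V) (e : vexpr) : V :=
  match e with
  | EZero => vzero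
  | EAtom i => nth i env vzero
  | EAdd e f => vadd (vden env e) (vden env f)
  | EOpp e => vopp (vden env e)
  | EScal a e => vscal a (vden env e)
  end.

Fixpoint vcoef (e : vexpr) (i : nat) : R :=
  match e with
  | EZero => 0
  | EAtom j => if Nat.eqb i j then 1 else 0
  | EAdd e f => vcoef e i + vcoef f i
  | EOpp e => - vcoef e i
  | EScal a e => a * vcoef e i
  end.

Fixpoint vlin (c : nat -> R) (env : list V) : V :=
  match env with
  | nil => vzero
  | x :: env' => vadd (vscal (c 0%nat) x) (vlin (fun i => c (S i)) env')
  end.

Lemma vlin_add c d env :
  vlin (fun i => c i + d i) env = vadd (vlin c env) (vlin d env).
Proof.
  revert c d; induction env as [|x env IH]; intros c d; simpl.
  - now rewrite vadd0.
  - rewrite (IH (fun i => c (S i)) (fun i => d (S i))), vscalDl.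
    rewrite <- !vaddA. f_equal. rewrite !vaddA. f_equal. apply vaddC.
Qed.

Lemma vlin_scal a c env : vlin (fun i => a * c i) env = vscal a (vlin c env).
Proof.
  revert c; induction env as [|x env IH]; intros c; simpl.
  - now rewrite vscal_zero.
  - now rewrite (IH (fun i => c (S i))), vscalDr, vscalA.
Qed.

Lemma vlin_ext c d env : (forall i, c i = d i) -> vlin c env = vlin d env.
Proof.
  revert c d; induction env as [|x env IH]; intros c d H; simpl; [easy|].
  rewrite H. f_equal. apply IH. intros i; apply H.
Qed.

Lemma vlin_0 env : vlin (fun _ => 0) env = vzero.
Proof.
  induction env as [|x env IH]; simpl; [easy|].
  now rewrite IH, vscal0, vadd0.
Qed.

Lemma vlin_atom j env :
  vlin (fun i => if Nat.eqb i j then 1 else 0) env = nth j env vzero.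
Proof.
  revert j; induction env as [|x env IH]; intros [|j]; simpl; try easy.
  - now rewrite vlin_0, vscal1, vadd0.
  - now rewrite IH, vscal0, vaddC, vadd0.
Qed.

Lemma vden_vlin env e : vden env e = vlin (vcoef e) env.
Proof.
  induction e as [|i|e IHe f IHf|e IH|a e IH]; simpl.
  - symmetry; apply vlin_0.
  - symmetry; apply vlin_atom.
  - now rewrite vlin_add, IHe, IHf.
  - rewrite IH, vopp_scal, <- vlin_scal. apply vlin_ext; intros; ring.
  - now rewrite vlin_scal, IH.
Qed.

(** By recursion on the list of atoms, so that for a concrete [env] it computes to a finite
    conjunction of equations in [R]. *)
Fixpoint coef_agree (c d : nat -> R) (env : list V) : Prop :=
  match env with
  | nil => True
  | _ :: env' =>
      c 0%nat = d 0%nat /\ coef_agree (fun i => c (S i)) (fun i => d (S i)) env'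
  end.

Lemma vden_eq env e f :
  coef_agree (vcoef e) (vcoef f) env -> vden env e = vden env f.
Proof.
  rewrite !vden_vlin. generalize (vcoef e) (vcoef f).
  induction env as [|x env IH]; simpl; [easy|].
  intros c d [H1 H2]. rewrite H1. f_equal. now apply IH.
Qed.

End VectorIdentities.

Ltac vatom_add x l :=
  lazymatch l with
  | context [cons x _] => l
  | _ => constr:(cons x l)
  end.

Ltac vatoms l e :=
  lazymatch e with
  | vzero => l
  | vadd ?a ?b => let l' := vatoms l a in vatoms l' b
  | vopp ?a => vatoms l a
  | vscal _ ?a => vatoms l a
  | _ => vatom_add e l
  end.

Ltac vindex x l :=
  lazymatch l with
  | cons x _ => constr:(O)
  | cons _ ?l' => let i := vindex x l' in constr:(S i)
  end.

Ltac vreify l e :=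
  lazymatch e with
  | vzero => constr:(EZero)
  | vadd ?a ?b =>
      let a' := vreify l a in let b' := vreify l b in constr:(EAdd a' b')
  | vopp ?a => let a' := vreify l a in constr:(EOpp a')
  | vscal ?r ?a => let a' := vreify l a in constr:(EScal r a')
  | _ => let i := vindex e l in constr:(EAtom i)
  end.

(** Leaves the coefficient equations open, for identities that divide by a step [h] and call for
    [field]. *)
Ltac vec_coef :=
  unfold vsub;
  match goal with
  | |- @eq (vcar ?V) ?x ?y =>
      let l0 := vatoms (@nil (vcar V)) x in
      let l := vatoms l0 y in
      let e := vreify l x in
      let f := vreify l y in
      apply (vden_eq V l e f); simpl; repeat split
  end.

Ltac vec := vec_coef; try ring.

(** * Geometric error terms *)

Lemma geometric_small c q e :
  0 <= q < 1 -> 0 < e -> exists N, forall k, (N <= k)%nat -> c * q ^ k < e.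
Proof.
  intros Hq He. assert (Hc := Rabs_pos c).
  destruct (pow_lt_1_zero q ltac:(rewrite Rabs_pos_eq; lra) (e / (Rabs c + 1))) as [N HN].
  { apply Rdiv_lt_0_compat; lra. }
  exists N. intros k Hk. specialize (HN k Hk).
  assert (H1 := Rle_abs c). assert (H2 : 0 <= q ^ k) by now apply pow_le.
  rewrite Rabs_pos_eq in HN by easy.
  apply (Rmult_lt_compat_l (Rabs c + 1)) in HN; [|lra].
  replace ((Rabs c + 1) * (e / (Rabs c + 1))) with e in HN by (field; lra). nra.
Qed.

(** Lets the Picard index tend to infinity inside an estimate between fixed quantities. *)
Lemma le_geometric_limit a b c q :
  0 <= q < 1 -> (forall k : nat, a <= b + c * q ^ k) -> a <= b.
Proof.
  intros Hq H. apply le_epsilon. intros e He.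
  destruct (geometric_small c q e Hq He) as [k Hk].
  specialize (Hk k (le_n k)). specialize (H k). lra.
Qed.

(** * Banach subspaces *)

Section BanachSubspace.
Variables (V : VSpace) (P : V -> Prop) (n : V -> R).
Hypothesis HB : is_banach P n.

Lemma ban_0 : P vzero.
Proof. apply HB. Qed.
Lemma ban_add x y : P x -> P y -> P (vadd x y).
Proof. apply HB. Qed.
Lemma ban_scal a x : P x -> P (vscal a x).
Proof. apply HB. Qed.
Lemma ban_opp x : P x -> P (vopp x).
Proof. rewrite vopp_scal. apply ban_scal. Qed.
Lemma ban_sub x y : P x -> P y -> P (vsub x y).
Proof. intros; apply ban_add; [|apply ban_opp]; easy. Qed.

Lemma norm_ge0 x : P x -> 0 <= n x.
Proof. apply HB. Qed.
Lemma norm_scal_eq a x : P x -> n (vscal a x) = Rabs a * n x.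
Proof. apply HB. Qed.
Lemma norm_add_le x y : P x -> P y -> n (vadd x y) <= n x + n y.
Proof. apply HB. Qed.
Lemma norm_zero : n vzero = 0.
Proof.
  rewrite <- (vscal0 _ vzero), norm_scal_eq, Rabs_R0 by apply ban_0. ring.
Qed.
Lemma norm_opp_eq x : P x -> n (vopp x) = n x.
Proof.
  intros Hx. rewrite vopp_scal, norm_scal_eq, Rabs_left by (easy || lra). ring.
Qed.
Lemma norm_sub_le x y : P x -> P y -> n (vsub x y) <= n x + n y.
Proof.
  intros Hx Hy. rewrite <- (norm_opp_eq y) by easy.
  apply norm_add_le; [|apply ban_opp]; easy.
Qed.
Lemma norm_sub_sym x y : P x -> P y -> n (vsub x y) = n (vsub y x).
Proof.
  intros Hx Hy. rewrite <- (norm_opp_eq (vsub x y)) by now apply ban_sub.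
  f_equal. vec.
Qed.
Lemma norm_dist_tri x y z :
  P x -> P y -> P z -> n (vsub x z) <= n (vsub x y) + n (vsub y z).
Proof.
  intros Hx Hy Hz. replace (vsub x z) with (vadd (vsub x y) (vsub y z)) by vec.
  apply norm_add_le; apply ban_sub; easy.
Qed.
Lemma norm_sub_ge x y : P x -> P y -> n x - n y <= n (vsub x y).
Proof.
  intros Hx Hy.
  assert (H := norm_add_le (vsub x y) y (ban_sub _ _ Hx Hy) Hy).
  replace (vadd (vsub x y) y) with x in H by vec. lra.
Qed.

Lemma seq_conv_unique f l l' :
  (forall k, P (f k)) -> P l -> P l' ->
  seq_conv n f l -> seq_conv n f l' -> l = l'.
Proof.
  intros Hf Hl Hl' H H'.
  assert (E : n (vsub l l') = 0).
  { apply Rle_antisym; [|apply norm_ge0, ban_sub; easy].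
    apply le_epsilon. intros e He.
    destruct (H (e / 2)) as [k1 H1]; [lra|]. destruct (H' (e / 2)) as [k2 H2]; [lra|].
    set (k := (k1 + k2)%nat).
    assert (A := H1 k ltac:(lia)). assert (A' := H2 k ltac:(lia)).
    rewrite norm_sub_sym in A by easy.
    assert (T := norm_dist_tri l (f k) l' Hl (Hf k) Hl'). lra. }
  apply HB in E; [|apply ban_sub; easy].
  replace l with (vadd (vsub l l') l') by vec. rewrite E. vec.
Qed.

Lemma geometric_cauchy (x : nat -> V) (K q : R) :
  (forall k, P (x k)) -> 0 <= q < 1 ->
  (forall k, n (vsub (x (S k)) (x k)) <= K * q ^ k) ->
  forall k m, n (vsub (x (k + m)%nat) (x k)) <= K / (1 - q) * q ^ k.
Proof.
  intros Hx Hq Hd k m.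
  assert (HK : 0 <= K).
  { specialize (Hd O). assert (H := norm_ge0 _ (ban_sub _ _ (Hx 1%nat) (Hx O))).
    simpl in Hd. lra. }
  (* Unlike the bound of the statement, the exact geometric partial sum is reproduced by the
     induction on [m]. *)
  assert (H : n (vsub (x (k + m)%nat) (x k)) <= K / (1 - q) * (q ^ k - q ^ (k + m))).
  { induction m as [|m IH].
    - rewrite Nat.add_0_r. replace (vsub (x k) (x k)) with (@vzero V) by vec.
      rewrite norm_zero. lra.
    - rewrite Nat.add_succ_r. simpl.
      assert (H1 := norm_dist_tri _ _ _ (Hx (S (k + m))) (Hx (k + m)%nat) (Hx k)).
      specialize (Hd (k + m)%nat).
      replace (K / (1 - q) * (q ^ k - q * q ^ (k + m))) with
        (K * q ^ (k + m) + K / (1 - q) * (q ^ k - q ^ (k + m))) by (field; lra).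
      lra. }
  apply Rle_trans with (1 := H), Rmult_le_compat_l.
  - apply Rmult_le_pos; [easy|]. apply Rlt_le, Rinv_0_lt_compat. lra.
  - assert (0 <= q ^ (k + m)) by now apply pow_le. lra.
Qed.

Lemma geometric_limit (x : nat -> V) (K q : R) :
  (forall k, P (x k)) -> 0 <= q < 1 ->
  (forall k, n (vsub (x (S k)) (x k)) <= K * q ^ k) ->
  exists l, P l /\ seq_conv n x l /\
    forall k, n (vsub l (x k)) <= K / (1 - q) * q ^ k.
Proof.
  intros Hx Hq Hd.
  assert (HC := geometric_cauchy x K q Hx Hq Hd).
  set (L := K / (1 - q)) in *.
  destruct HB as (_ & _ & Hcomp).
  destruct (Hcomp x Hx) as [l [Hl Hconv]].
  { intros e He. destruct (geometric_small L q (e / 2) Hq ltac:(lra)) as [N HN].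
    exists N. intros p r Hp Hr.
    assert (A := HC N (p - N)%nat). assert (A' := HC N (r - N)%nat).
    replace (N + (p - N))%nat with p in A by lia.
    replace (N + (r - N))%nat with r in A' by lia.
    specialize (HN N (le_n N)).
    rewrite norm_sub_sym in A' by easy.
    assert (T := norm_dist_tri (x p) (x N) (x r) (Hx _) (Hx _) (Hx _)). lra. }
  exists l; split; [easy|]; split; [easy|]. intros k.
  apply le_epsilon. intros e He. destruct (Hconv e He) as [N HN].
  specialize (HN (k + N)%nat ltac:(lia)). specialize (HC k N).
  rewrite norm_sub_sym in HN by easy.
  assert (T := norm_dist_tri l (x (k + N)%nat) (x k) Hl (Hx _) (Hx _)). lra.
Qed.

End BanachSubspace.

(** * The uniform boundedness principle *)

Section UniformBoundedness.
Variables (V : VSpace) (P P' : V -> Prop) (n n' : V -> R) (I : Type) (T : I -> V -> V).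
Hypothesis HB : is_banach P n.
Hypothesis HB' : is_banach P' n'.
Hypothesis T_in : forall i x, P x -> P' (T i x).
Hypothesis T_add : forall i x y, P x -> P y -> T i (vadd x y) = vadd (T i x) (T i y).
Hypothesis T_scal : forall i a x, P x -> T i (vscal a x) = vscal a (T i x).

(** [L] is the operator norm of [T i], a supremum over the unit ball. The fraction [3 / 4] is chosen
    above [1 / 2], which is what the tail of the hump series takes away in the next theorem. *)
Lemma near_norm_attaining i :
  (exists K, forall x, P x -> n' (T i x) <= K * n x) ->
  exists L, 0 <= L /\ (forall x, P x -> n' (T i x) <= L * n x) /\
    (0 < L -> exists y, P y /\ n y <= 1 /\ 3 / 4 * L < n' (T i y)).
Proof.
  intros [K HK].
  set (E := fun r => exists y, P y /\ n y <= 1 /\ r = n' (T i y)).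
  assert (E0 : E (n' (T i vzero))).
  { exists vzero. split; [apply (ban_0 _ _ _ HB)|].
    rewrite (norm_zero _ _ _ HB). split; [lra|easy]. }
  destruct (completeness E) as [L [HL1 HL2]].
  - exists (Rabs K). intros r [y [Hy [H1 ->]]].
    apply Rle_trans with (1 := HK y Hy).
    assert (H2 := norm_ge0 _ _ _ HB _ Hy). assert (H3 := Rle_abs K).
    assert (H4 := Rabs_pos K). nra.
  - now exists (n' (T i vzero)).
  - assert (L0 : 0 <= L).
    { apply Rle_trans with (2 := HL1 _ E0).
      apply (norm_ge0 _ _ _ HB'), T_in, (ban_0 _ _ _ HB). }
    exists L. split; [easy|]. split.
    + intros x Hx. destruct (Rle_lt_or_eq_dec _ _ (norm_ge0 _ _ _ HB _ Hx)) as [Hn|Hn].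
      * assert (H1 : n' (T i (vscal (/ n x) x)) <= L).
        { apply HL1. exists (vscal (/ n x) x).
          split; [now apply (ban_scal _ _ _ HB)|]. split; [|easy].
          rewrite (norm_scal_eq _ _ _ HB), Rabs_pos_eq by
            (try apply Rlt_le, Rinv_0_lt_compat; easy).
          rewrite Rinv_l; lra. }
        rewrite T_scal, (norm_scal_eq _ _ _ HB'), Rabs_pos_eq in H1 by
          (try apply T_in; try apply Rlt_le, Rinv_0_lt_compat; easy).
        apply (Rmult_le_compat_r (n x)) in H1; [|lra].
        replace (/ n x * n' (T i x) * n x) with (n' (T i x)) in H1 by (field; lra).
        easy.
      * assert (H1 := HK x Hx). rewrite <- Hn in *. lra.
    + intros Lpos. apply NNPP. intros Hno.
      assert (H1 : L <= 3 / 4 * L).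
      { apply HL2. intros r [y [Hy [H1 ->]]].
        apply Rnot_lt_le. intros H2. apply Hno. now exists y. }
      lra.
Qed.

(* Gliding hump: of [x + y] and [x - y] one has an image at least as large as
   that of [y], so a sum of small humps [y_k], each nearly attaining the norm
   of a [T i_k] with norm above [4 ^ k], violates pointwise boundedness. *)
Theorem uniform_boundedness :
  (forall i, exists K, forall x, P x -> n' (T i x) <= K * n x) ->
  (forall x, P x -> exists K, forall i, n' (T i x) <= K) ->
  exists K, 0 <= K /\ forall i x, P x -> n' (T i x) <= K * n x.
Proof.
  intros Hbd Hpt. apply NNPP. intros Hno.
  assert (Hump : forall k : nat, exists z : I * (V * R),
    let i := fst z in let y := fst (snd z) in let L := snd (snd z) in
    P y /\ n y <= 1 /\ 4 ^ k < L /\ 3 / 4 * L < n' (T i y) /\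
    (forall x, P x -> n' (T i x) <= L * n x)).
  (* Without a hump at level [k], [4 ^ k] itself would be a uniform bound. *)
  { intros k. apply NNPP. intros Hk. apply Hno. exists (4 ^ k).
    assert (H4 : 0 < 4 ^ k) by (apply pow_lt; lra). split; [lra|].
    intros i x Hx.
    destruct (near_norm_attaining i (Hbd i)) as [L [L0 [HL Hy]]].
    apply Rle_trans with (1 := HL x Hx).
    apply Rmult_le_compat_r; [now apply (norm_ge0 _ _ _ HB)|].
    apply Rnot_lt_le. intros HkL. apply Hk.
    destruct Hy as [y [Hy1 [Hy2 Hy3]]]; [lra|].
    exists (i, (y, L)). repeat split; easy. }
  apply choice in Hump. destruct Hump as [z Hz].
  set (i := fun k => fst (z k)).
  set (y := fun k => fst (snd (z k))). set (L := fun k => snd (snd (z k))).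
  assert (Hy : forall k, P (y k)) by (intros k; apply (Hz k)).
  set (hump := fun k => vscal ((/ 3) ^ S k) (y k)).
  assert (Hh : forall k, P (hump k)) by (intros k; now apply (ban_scal _ _ _ HB)).
  set (x := nat_rect (fun _ => V) vzero (fun k xk =>
    if Rle_lt_dec (n' (T (i k) (hump k))) (n' (T (i k) (vadd xk (hump k))))
    then vadd xk (hump k) else vsub xk (hump k))).
  assert (Hx : forall k, P (x k)).
  { induction k as [|k IH]; simpl; [apply (ban_0 _ _ _ HB)|].
    destruct (Rle_lt_dec _ _);
      [apply (ban_add _ _ _ HB)|apply (ban_sub _ _ _ HB)]; easy. }
  assert (H3 : forall k, 0 < (/ 3) ^ k) by (intros k; apply pow_lt; lra).
  assert (Hhn : forall k, n (hump k) <= (/ 3) ^ S k).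
  { intros k. unfold hump.
    rewrite (norm_scal_eq _ _ _ HB), Rabs_pos_eq by (try apply Rlt_le; easy).
    destruct (Hz k) as (_ & H & _). fold (y k) in H. specialize (H3 (S k)). nra. }
  assert (Hstep : forall k, n (vsub (x (S k)) (x k)) <= / 3 * (/ 3) ^ k).
  { intros k. simpl x. change (/ 3 * (/ 3) ^ k) with ((/ 3) ^ S k).
    destruct (Rle_lt_dec _ _).
    - replace (vsub (vadd (x k) (hump k)) (x k)) with (hump k) by vec. easy.
    - replace (vsub (vsub (x k) (hump k)) (x k)) with (vopp (hump k)) by vec.
      rewrite (norm_opp_eq _ _ _ HB); easy. }
  assert (Hbig : forall k, n' (T (i k) (hump k)) <= n' (T (i k) (x (S k)))).
  { intros k. simpl x. destruct (Rle_lt_dec _ _) as [H|H]; [easy|].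
    assert (Hxk := Hx k). assert (Hhk := Hh k).
    unfold vsub. rewrite T_add in * by (try apply (ban_opp _ _ _ HB); easy).
    rewrite (vopp_scal _ (hump k)), T_scal by easy.
    set (a := T (i k) (x k)) in *. set (b := T (i k) (hump k)) in *.
    assert (Ha : P' a) by now apply T_in. assert (Hb : P' b) by now apply T_in.
    assert (Hs : P' (vscal (-1) b)) by now apply (ban_scal _ _ _ HB').
    assert (E := norm_sub_le _ _ _ HB' (vadd a b) (vadd a (vscal (-1) b))
      (ban_add _ _ _ HB' _ _ Ha Hb) (ban_add _ _ _ HB' _ _ Ha Hs)).
    replace (vsub (vadd a b) (vadd a (vscal (-1) b))) with (vscal 2 b) in E by vec.
    rewrite (norm_scal_eq _ _ _ HB'), Rabs_pos_eq in E by (easy || lra). lra. }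
  destruct (geometric_limit _ _ _ HB x (/ 3) (/ 3) Hx ltac:(lra) Hstep)
    as (l & Hl & _ & Hlx).
  destruct (Hpt l Hl) as [K HK].
  (* Operator norms grow like [4 ^ k] and humps shrink like [3 ^ (- (k + 1))], so the images grow
     like [(4 / 3) ^ k / 3]. A quarter of this survives the tail, whence [12 = 3 * 4]. *)
  destruct (Pow_x_infinity (4 / 3) ltac:(rewrite Rabs_pos_eq; lra) (12 * (Rabs K + 1)))
    as [k Hk].
  specialize (Hk k (le_n k)). specialize (HK (i k)).
  destruct (Hz k) as (_ & _ & HL4 & HLy & HLx).
  fold (i k) (y k) (L k) in *.
  assert (A1 := HLx _ (ban_sub _ _ _ HB _ _ Hl (Hx (S k)))).
  replace (vsub l (x (S k))) with (vadd l (vscal (-1) (x (S k)))) in A1 at 1 by vec.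
  rewrite T_add, T_scal in A1 by (try apply (ban_scal _ _ _ HB); easy).
  assert (A2 := norm_sub_ge _ _ _ HB' (T (i k) (x (S k))) (T (i k) l)
    (T_in _ _ (Hx _)) (T_in _ _ Hl)).
  rewrite (norm_sub_sym _ _ _ HB') in A2 by (apply T_in; easy).
  replace (vsub (T (i k) l) (T (i k) (x (S k)))) with
    (vadd (T (i k) l) (vscal (-1) (T (i k) (x (S k))))) in A2 by vec.
  assert (A3 := Hbig k). unfold hump in A3.
  rewrite T_scal, (norm_scal_eq _ _ _ HB'), Rabs_pos_eq in A3 by
    (try apply T_in; try apply Rlt_le; easy).
  assert (A4 := Hlx (S k)).
  replace (/ 3 / (1 - / 3) * (/ 3) ^ S k) with (/ 2 * (/ 3) ^ S k) in A4 by field.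
  set (p := (/ 3) ^ S k) in *. assert (Hp := H3 (S k)). fold p in Hp.
  assert (Lpos : 0 < L k) by (assert (0 < 4 ^ k) by (apply pow_lt; lra); lra).
  assert (A5 : / 4 * (p * L k) <= K).
  (* The humps after the [k]-th sum up to at most [p / 2], which leaves [3 / 4 - 1 / 2] of
     [p * L k]. *)
  { assert (p * (3 / 4 * L k) <= p * n' (T (i k) (y k)))
      by (apply Rmult_le_compat_l; lra).
    assert (L k * n (vsub l (x (S k))) <= L k * (/ 2 * p))
      by (apply Rmult_le_compat_l; lra). lra. }
  assert (A6 : p * 4 ^ k <= p * L k) by (apply Rmult_le_compat_l; lra).
  assert (A7 : (4 / 3) ^ k = 3 * (p * 4 ^ k)).
  { unfold p. replace (4 / 3) with (/ 3 * 4) by field.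
    rewrite Rpow_mult_distr. simpl. field. }
  rewrite Rabs_pos_eq in Hk by (apply pow_le; lra).
  assert (A8 := Rle_abs K). lra.
Qed.

End UniformBoundedness.

(** * Integration in a Banach subspace *)

Section BanachSpaceType.
Variables (V : VSpace) (P : V -> Prop) (n : V -> R).
Hypothesis HB : is_banach P n.

(** The subspace is turned into a complete normed module of its own, in order to use the Riemann
    integral [RInt] of functions with values in it. *)
Definition bcar := {x : V | P x}.

Lemma bcar_eq (x y : bcar) : proj1_sig x = proj1_sig y -> x = y.
Proof.
  destruct x as [x Hx], y as [y Hy]. simpl. intros <-. f_equal. apply proof_irrelevance.
Qed.

Definition bzero : bcar := exist _ vzero (ban_0 _ _ _ HB).
Definition badd (x y : bcar) : bcar :=
  exist _ _ (ban_add _ _ _ HB _ _ (proj2_sig x) (proj2_sig y)).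
Definition bopp (x : bcar) : bcar := exist _ _ (ban_opp _ _ _ HB _ (proj2_sig x)).
Definition bscal (a : R) (x : bcar) : bcar :=
  exist _ _ (ban_scal _ _ _ HB a _ (proj2_sig x)).
Definition bnorm (x : bcar) : R := n (proj1_sig x).
Definition bball (x : bcar) (e : R) (y : bcar) : Prop :=
  n (vsub (proj1_sig y) (proj1_sig x)) < e.

Definition b_AbelianMonoid_mixin : AbelianMonoid.mixin_of bcar.
Proof.
  apply (AbelianMonoid.Mixin bcar badd bzero); intros; apply bcar_eq; simpl; vec.
Defined.
Definition b_AbelianMonoid := AbelianMonoid.Pack bcar b_AbelianMonoid_mixin bcar.

Definition b_AbelianGroup_mixin : AbelianGroup.mixin_of b_AbelianMonoid.
Proof.
  apply (AbelianGroup.Mixin b_AbelianMonoid bopp); intros; apply bcar_eq; simpl; vec.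
Defined.
Definition b_AbelianGroup_class :=
  AbelianGroup.Class bcar b_AbelianMonoid_mixin b_AbelianGroup_mixin.
Definition b_AbelianGroup := AbelianGroup.Pack bcar b_AbelianGroup_class bcar.

Definition b_ModuleSpace_mixin : ModuleSpace.mixin_of R_AbsRing b_AbelianGroup.
Proof.
  apply (ModuleSpace.Mixin R_AbsRing b_AbelianGroup bscal); intros; apply bcar_eq;
    simpl; vec_coef; unfold mult, one, plus; simpl; ring.
Defined.
Definition b_ModuleSpace_class :=
  ModuleSpace.Class R_AbsRing bcar b_AbelianGroup_class b_ModuleSpace_mixin.

Definition b_UniformSpace_mixin : UniformSpace.mixin_of bcar.
Proof.
  apply (UniformSpace.Mixin bcar bzero bball); unfold bball.
  - intros x e. replace (vsub (proj1_sig x) (proj1_sig x)) with (@vzero V) by vec.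
    rewrite (norm_zero _ _ _ HB). apply cond_pos.
  - intros x y e. rewrite (norm_sub_sym _ _ _ HB); [easy|apply proj2_sig..].
  - intros x y z e1 e2 H1 H2.
    assert (H := norm_dist_tri _ _ _ HB _ _ _ (proj2_sig z) (proj2_sig y) (proj2_sig x)).
    lra.
Defined.
Definition b_UniformSpace := UniformSpace.Pack bcar b_UniformSpace_mixin bcar.

Definition b_NormedModuleAux_class :=
  NormedModuleAux.Class R_AbsRing bcar b_ModuleSpace_class b_UniformSpace_mixin.
Definition b_NormedModuleAux :=
  NormedModuleAux.Pack R_AbsRing bcar b_NormedModuleAux_class bcar.

Definition b_NormedModule_mixin : NormedModule.mixin_of R_AbsRing b_NormedModuleAux.
Proof.
  apply (NormedModule.Mixin R_AbsRing b_NormedModuleAux bnorm 1).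
  - intros x y. apply (norm_add_le _ _ _ HB); apply proj2_sig.
  - intros a x. apply Req_le, (norm_scal_eq _ _ _ HB), proj2_sig.
  - intros x y e H. exact H.
  - intros x y e H. rewrite Rmult_1_l. exact H.
  - intros x H. apply bcar_eq. apply HB; [apply proj2_sig|exact H].
Defined.
Definition b_NormedModule_class :=
  NormedModule.Class R_AbsRing bcar b_NormedModuleAux_class b_NormedModule_mixin.

(** The hypothesis speaks of sequences, the structure of filters. Centres of balls of radius
    [(/ 2) ^ k] that belong to the filter form a geometric sequence, because two members of a proper
    filter meet. *)
Lemma banach_filter_complete (F : (b_UniformSpace -> Prop) -> Prop) :
  ProperFilter F -> cauchy F -> exists l : b_UniformSpace,
    forall eps : posreal, F (ball l eps).
Proof.
  intros HF Hc.
  assert (H2 : forall k, 0 < (/ 2) ^ k) by (intros k; apply pow_lt; lra).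
  assert (Hx : forall k : nat, exists x : b_UniformSpace, F (ball x ((/ 2) ^ k))).
  { intros k. exact (Hc (mkposreal _ (H2 k))). }
  apply choice in Hx. destruct Hx as [x Hx].
  assert (Hd : forall k m, n (vsub (proj1_sig (x k)) (proj1_sig (x m)))
    < (/ 2) ^ k + (/ 2) ^ m).
  { intros k m.
    destruct (filter_ex _ (filter_and _ _ (Hx k) (Hx m))) as [y [H1 H3]].
    unfold ball in H1, H3. simpl in H1, H3. unfold bball in H1, H3.
    rewrite (norm_sub_sym _ _ _ HB) in H1 by apply proj2_sig.
    assert (T := norm_dist_tri _ _ _ HB _ _ _
      (proj2_sig (x k)) (proj2_sig y) (proj2_sig (x m))). lra. }
  destruct (geometric_limit _ _ _ HB (fun k => proj1_sig (x k)) 2 (/ 2))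
    as (l & Hl & _ & Hlx).
  - intros k; apply proj2_sig.
  - lra.
  - intros k. specialize (Hd (S k) k). specialize (H2 k). simpl in Hd. lra.
  - exists (exist _ l Hl). intros eps.
    (* With the constant [2], the [k]-th centre is within [4 * (/ 2) ^ k] of the limit; the radius
       of the ball is the fifth part. *)
    destruct (pow_lt_1_zero (/ 2) ltac:(rewrite Rabs_pos_eq; lra) (eps / 5)) as [k Hk].
    { assert (H := cond_pos eps). lra. }
    specialize (Hk k (le_n k)). rewrite Rabs_pos_eq in Hk by apply Rlt_le, H2.
    apply (filter_imp (ball (x k) ((/ 2) ^ k))); [|apply Hx].
    intros y Hy. unfold ball in *. simpl in *. unfold bball in *. simpl.
    assert (T := norm_dist_tri _ _ _ HB _ _ _ (proj2_sig y) (proj2_sig (x k)) Hl).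
    specialize (Hlx k). rewrite (norm_sub_sym _ _ _ HB) in Hlx by
      (easy || apply proj2_sig). lra.
Qed.

Definition blim (F : (b_UniformSpace -> Prop) -> Prop) : b_UniformSpace :=
  epsilon (inhabits bzero) (fun l : b_UniformSpace => forall eps : posreal, F (ball l eps)).

Definition b_CompleteSpace_mixin : CompleteSpace.mixin_of b_UniformSpace.
Proof.
  apply (CompleteSpace.Mixin b_UniformSpace blim).
  - intros F HF Hc. exact (epsilon_spec (inhabits bzero)
      (fun l : b_UniformSpace => forall eps : posreal, F (ball l eps))
      (banach_filter_complete F HF Hc)).
  (* [blim] is a choice made for each filter, so filters with the same members have to be identified
     as objects. *)
  - intros F G H1 H2 eps. replace G with F; [apply ball_center|].
    apply functional_extensionality. intros Q. apply propositional_extensionality.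
    split; [apply H2|apply H1].
Defined.

Definition bspace : CompleteNormedModule R_AbsRing :=
  CompleteNormedModule.Pack R_AbsRing bcar
    (CompleteNormedModule.Class R_AbsRing bcar b_NormedModule_class
      b_CompleteSpace_mixin) bcar.

(** Decides membership classically, so that integrands stay plain functions into [V]; zero is a
    dummy value outside [P]. *)
Definition bproj (x : V) : bspace :=
  match excluded_middle_informative (P x) with
  | left Hx => exist _ x Hx
  | right _ => bzero
  end.

Lemma bprojK x : P x -> proj1_sig (bproj x : bcar) = x.
Proof. intros Hx. unfold bproj. now destruct (excluded_middle_informative _). Qed.

Definition vcontinuous (f : R -> V) : Prop :=
  forall t0 eps, 0 < eps -> exists delta, 0 < delta /\
    forall t, Rabs (t - t0) < delta -> n (vsub (f t) (f t0)) < eps.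

(** The integral is returned to [V], where integrals taken in different spaces of the scale can be
    equated. *)
Definition vint (f : R -> V) (a b : R) : V :=
  proj1_sig (RInt (V := bspace) (fun r => bproj (f r)) a b : bcar).

Lemma vint_in f a b : P (vint f a b).
Proof. exact (proj2_sig (RInt (V := bspace) (fun r => bproj (f r)) a b : bcar)). Qed.

Lemma vint_ext f g a b :
  a <= b -> (forall r, a <= r <= b -> f r = g r) -> vint f a b = vint g a b.
Proof.
  intros Hab H. unfold vint. f_equal. apply RInt_ext.
  rewrite Rmin_left, Rmax_right by easy. intros r Hr. rewrite H; [easy|lra].
Qed.

Section ContinuousIntegrand.
Variable f : R -> V.
Hypothesis Hf : forall t, P (f t).
Hypothesis Hc : vcontinuous f.

Lemma vint_integrable a b : ex_RInt (V := bspace) (fun r => bproj (f r)) a b.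
Proof.
  apply ex_RInt_continuous. intros t0 _. apply filterlim_locally. intros eps.
  destruct (Hc t0 eps (cond_pos eps)) as [delta [Hd Hdelta]].
  exists (mkposreal delta Hd). intros t Ht.
  unfold ball. simpl. unfold bball. rewrite !bprojK by easy. now apply Hdelta.
Qed.

Lemma vint_correct a b :
  is_RInt (V := bspace) (fun r => bproj (f r)) a b
    (RInt (V := bspace) (fun r => bproj (f r)) a b).
Proof.
  assert (H := RInt_correct _ _ _ (vint_integrable a b)). exact H.
Qed.

Lemma vint_chasles a b c : vint f a c = vadd (vint f a b) (vint f b c).
Proof.
  unfold vint. rewrite <- (RInt_Chasles _ a b c) by apply vint_integrable. easy.
Qed.

Lemma vint_norm_le g a b :
  a <= b -> (forall r, a <= r <= b -> n (f r) <= g r) -> ex_RInt g a b ->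
  n (vint f a b) <= RInt g a b.
Proof.
  intros Hab H Hg.
  apply (norm_RInt_le (V := bspace) (fun r => bproj (f r)) g a b
    (RInt (V := bspace) (fun r => bproj (f r)) a b) (RInt g a b)); [easy| | |].
  - intros r Hr. unfold norm. simpl. unfold bnorm. rewrite bprojK by easy. now apply H.
  - exact (vint_correct a b).
  - assert (H' := RInt_correct _ _ _ Hg). exact H'.
Qed.

(** Source of the term [h Z (u t) + o(h)]: on a short interval the Duhamel integrand is nearly
    constant. *)
Lemma vint_near_const z e a b :
  P z -> a <= b -> (forall r, a <= r <= b -> n (vsub (f r) z) <= e) ->
  n (vsub (vint f a b) (vscal (b - a) z)) <= (b - a) * e.
Proof.
  intros Hz Hab H.
  set (z' := exist P z Hz : bspace).
  assert (Hint : is_RInt (V := bspace) (fun r => minus (bproj (f r)) z') a b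
    (minus (RInt (V := bspace) (fun r => bproj (f r)) a b) (scal (b - a) z'))).
  { assert (H1 := is_RInt_const (V := bspace) a b z').
    exact (is_RInt_minus _ _ _ _ _ _ (vint_correct a b) H1). }
  refine (norm_RInt_le_const _ a b _ e Hab _ Hint).
  intros r Hr. unfold norm. simpl. unfold bnorm. simpl. rewrite bprojK by easy.
  now apply H.
Qed.

End ContinuousIntegrand.

Lemma vint_sub f g a b :
  (forall t, P (f t)) -> (forall t, P (g t)) -> vcontinuous f -> vcontinuous g ->
  vint (fun r => vsub (f r) (g r)) a b = vsub (vint f a b) (vint g a b).
Proof.
  intros Hf Hg Hfc Hgc. unfold vint at 2 3.
  change (vsub (proj1_sig (RInt (V := bspace) (fun r => bproj (f r)) a b : bcar))
    (proj1_sig (RInt (V := bspace) (fun r => bproj (g r)) a b : bcar))) with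
    (proj1_sig (minus (RInt (V := bspace) (fun r => bproj (f r)) a b)
      (RInt (V := bspace) (fun r => bproj (g r)) a b) : bcar)).
  rewrite <- RInt_minus by now apply vint_integrable.
  unfold vint. f_equal. apply RInt_ext. intros r _. apply bcar_eq.
  simpl. rewrite !bprojK; try easy. now apply (ban_sub _ _ _ HB).
Qed.

End BanachSpaceType.

(** [L] commutes with every Riemann sum, so its continuity at the one point [y] carries the limit
    over. *)
Lemma is_RInt_linear (U W : NormedModule R_AbsRing) (L : U -> W) (f : R -> U) a b y :
  (forall x z, L (plus x z) = plus (L x) (L z)) ->
  (forall c x, L (scal c x) = scal c (L x)) ->
  filterlim L (locally y) (locally (L y)) ->
  is_RInt f a b y -> is_RInt (fun r => L (f r)) a b (L y).
Proof.
  intros Ladd Lscal Lcont Hf.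
  assert (Hsum : forall p, Riemann_sum (fun r => L (f r)) p = L (Riemann_sum f p)).
  { intros p. induction p as [x|h p IH] using SF_cons_ind.
    - change (@zero W = L zero).
      transitivity (scal (@zero R_AbsRing) (L zero)).
      + symmetry. exact (scal_zero_l (L zero)).
      + rewrite <- Lscal. f_equal. exact (scal_zero_l (@zero U)).
    - now rewrite !Riemann_sum_cons, Ladd, Lscal, IH. }
  unfold is_RInt. apply filterlim_ext with
    (fun p => L (scal (sign (b - a)) (Riemann_sum f p))).
  - intros p. now rewrite Lscal, Hsum.
  - now apply filterlim_comp with (2 := Lcont).
Qed.

(** Used for the inclusion of one space of the scale into a larger one, and for taking [Sg h] out of
    an integral. *)
Lemma vint_linear (V : VSpace) (P P' : V -> Prop) (n n' : V -> R)
  (HB : is_banach P n) (HB' : is_banach P' n') (L : V -> V) (K : R) (f : R -> V) a b :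
  (forall x, P x -> P' (L x)) ->
  (forall x y, P x -> P y -> L (vadd x y) = vadd (L x) (L y)) ->
  (forall c x, P x -> L (vscal c x) = vscal c (L x)) ->
  (forall x, P x -> n' (L x) <= K * n x) ->
  (forall t, P (f t)) -> vcontinuous V n f ->
  vint V P' n' HB' (fun r => L (f r)) a b = L (vint V P n HB f a b).
Proof.
  intros Lin Ladd Lscal Lbd Hf Hc.
  set (L' := fun x : bspace V P n HB =>
    exist P' (L (proj1_sig (x : bcar V P))) (Lin _ (proj2_sig x)) : bspace V P' n' HB').
  set (y := RInt (V := bspace V P n HB) (fun r => bproj V P n HB (f r)) a b).
  change (L (vint V P n HB f a b)) with (proj1_sig (L' y : bcar V P')).
  unfold vint. f_equal. apply is_RInt_unique.
  apply is_RInt_ext with (fun r => L' (bproj V P n HB (f r))).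
  { intros r _. apply bcar_eq. simpl. rewrite !bprojK; auto. }
  apply is_RInt_linear.
  - intros x z. apply bcar_eq, Ladd; apply proj2_sig.
  - intros c x. apply bcar_eq, Lscal, proj2_sig.
  - apply filterlim_locally. intros eps.
    assert (HK : 0 < Rabs K + 1) by (assert (H := Rabs_pos K); lra).
    exists (mkposreal (eps / (Rabs K + 1)) (Rdiv_lt_0_compat _ _ (cond_pos eps) HK)).
    intros x Hx. unfold ball in *. simpl in *. unfold bball in *. simpl.
    assert (Hxp := proj2_sig x). assert (Hyp := proj2_sig y).
    set (x0 := proj1_sig x) in *. set (y0 := proj1_sig y) in *. simpl in Hxp, Hyp.
    replace (vsub (L x0) (L y0)) with (L (vsub x0 y0)).
    + apply Rle_lt_trans with (1 := Lbd _ (ban_sub _ _ _ HB _ _ Hxp Hyp)).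
      assert (H1 := norm_ge0 _ _ _ HB _ (ban_sub _ _ _ HB _ _ Hxp Hyp)).
      apply (Rmult_lt_compat_l (Rabs K + 1)) in Hx; [|easy].
      replace ((Rabs K + 1) * (eps / (Rabs K + 1))) with (pos eps) in Hx by (field; lra).
      assert (H2 := Rle_abs K). nra.
    + unfold vsub. rewrite Ladd by (try apply (ban_opp _ _ _ HB); easy).
      rewrite !vopp_scal. now rewrite Lscal.
  - exact (vint_correct V P n HB f Hf Hc a b).
Qed.

Arguments vint {V P n} HB f a b.
Arguments vcontinuous {V} n f.

(** * Elementary real estimates *)

Lemma Rmax0_lip t t' : Rabs (Rmax 0 t - Rmax 0 t') <= Rabs (t - t').
Proof.
  unfold Rmax. repeat destruct (Rle_dec _ _); unfold Rabs;
    repeat destruct (Rcase_abs _); lra.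
Qed.

Lemma pow_fact_le_exp x k : 0 <= x -> x ^ k / INR (fact k) <= exp x.
Proof.
  intros Hx.
  assert (Hpos : forall i, 0 <= / INR (fact i) * x ^ i).
  { intros i. apply Rmult_le_pos; [|now apply pow_le].
    apply Rlt_le, Rinv_0_lt_compat, INR_fact_lt_0. }
  apply Rle_trans with (sum_f_R0 (fun i => / INR (fact i) * x ^ i) k).
  - unfold Rdiv. rewrite Rmult_comm. destruct k as [|k]; simpl; [lra|].
    assert (H := cond_pos_sum _ k Hpos). simpl in H. lra.
  - apply sum_incr; [|easy]. unfold exp.
    destruct (exist_exp x) as [y Hy]. exact Hy.
Qed.

(** * The semigroup and the perturbation on the scale *)

Section Scale.
Variables (V : VSpace) (alo : R) (ahi : option R)
  (B : R -> V -> Prop) (nrm : R -> V -> R) (C D : R -> V -> Prop)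
  (Aop : V -> V) (Sem : R -> R -> V -> V) (nu omega : R)
  (M N : R -> R) (Z : V -> V).
Hypothesis HA1 : StdA1 alo ahi B nrm.
Hypothesis HA2 : StdA2 alo ahi B nrm C D Aop Sem nu omega.
Hypothesis HA3 : StdA3 alo ahi B nrm M N Z.
Variables (astar als : R) (us : V).
Hypothesis Hastar : inI alo ahi astar.
Hypothesis Hals : alo < als < astar.
Hypothesis Hus : B als us.

Lemma inI_between b : als <= b <= astar -> inI alo ahi b.
Proof.
  intros Hb. destruct Hastar as [H1 H2]. split; [lra|]. destruct ahi; [lra|easy].
Qed.

Lemma Ban b : als <= b <= astar -> is_banach (B b) (nrm b).
Proof. intros Hb. apply HA1. now apply inI_between. Qed.

Lemma B_incl a b x : als <= a -> a <= b -> b <= astar -> B a x -> B b x.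
Proof.
  intros H1 H2 H3. destruct HA1 as (_ & _ & _ & H).
  apply (H a b); try apply inI_between; lra.
Qed.

Lemma nrm_anti a b x : als <= a -> a <= b -> b <= astar -> B a x -> nrm b x <= nrm a x.
Proof.
  intros H1 H2 H3. destruct HA1 as (_ & _ & _ & H).
  apply (H a b); try apply inI_between; lra.
Qed.

Lemma B_BI a x : als <= a <= astar -> B a x -> BI alo ahi B x.
Proof. intros Ha Hx. exists a. split; [now apply inI_between|easy]. Qed.

(* The parts of the semigroup on all the spaces agree with the one on the
   largest space; it is extended by the identity to negative times, so that
   convolutions have integrands that are continuous on the whole line. *)
Definition Sg (t : R) : V -> V := Sem astar (Rmax 0 t).
(** With [Rabs omega] the bound is monotone in [t], so its value at the right end serves on a whole
    time interval. *)
Definition growth (t : R) : R := nu * exp (Rabs omega * Rmax 0 t).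

Lemma nu_ge1 : 1 <= nu.
Proof. apply HA2. Qed.

Lemma growth_ge1 t : 1 <= growth t.
Proof.
  unfold growth. assert (H := nu_ge1).
  assert (H1 : 0 <= Rabs omega * Rmax 0 t)
    by (apply Rmult_le_pos; [apply Rabs_pos|apply Rmax_l]).
  assert (H2 := exp_ineq1_le (Rabs omega * Rmax 0 t)). nra.
Qed.

Lemma growth_mono t t' : t <= t' -> growth t <= growth t'.
Proof.
  intros Ht. unfold growth. assert (H := nu_ge1). apply Rmult_le_compat_l; [lra|].
  destruct (Req_dec (Rmax 0 t) (Rmax 0 t')) as [->|Hne]; [lra|].
  destruct (Rle_lt_or_eq_dec _ _ (Rabs_pos omega)) as [Hw|<-].
  - apply Rlt_le, exp_increasing, Rmult_lt_compat_l; [easy|].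
    unfold Rmax in *; repeat destruct (Rle_dec _ _); lra.
  - rewrite !Rmult_0_l. lra.
Qed.

Lemma B_in_D g b x : als <= g -> g < b -> b <= astar -> B g x -> D b x.
Proof.
  intros H1 H2 H3. destruct HA2 as (_ & _ & _ & H & _).
  apply (H g b); try apply inI_between; lra.
Qed.

(** The semigroup laws are available on [C b] only. This is why the lemmas on [Sg] ask for [x] in a
    space strictly below the one in which the semigroup is considered. *)
Lemma B_in_C g b x : als <= g -> g < b -> b <= astar -> B g x -> C b x.
Proof.
  intros H1 H2 H3 Hx. destruct HA2 as (H & _).
  destruct (H b) as (_ & (_ & HD & _) & _); [apply inI_between; lra|].
  apply HD. now apply (B_in_D g).
Qed.

Lemma C_in_B b x : als <= b <= astar -> C b x -> B b x.
Proof.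
  intros Hb. destruct HA2 as (H & _).
  destruct (H b) as ((_ & HC & _) & _); [now apply inI_between|]. apply HC.
Qed.

Lemma Sg_in g t x : als <= g < astar -> B g x -> B g (Sg t x).
Proof.
  intros Hg. destruct HA2 as (_ & _ & _ & H & _).
  apply (H g astar); try apply inI_between; try lra. apply Rmax_l.
Qed.

Lemma Sg_eq g b t x : als <= g -> g < b -> b <= astar -> B g x ->
  Sg t x = Sem b (Rmax 0 t) x.
Proof.
  intros H1 H2 H3 Hx. destruct (Rle_lt_or_eq_dec _ _ H3) as [Hb | ->]; [|easy].
  destruct HA2 as (_ & _ & _ & H & _).
  apply (H b astar); try apply inI_between; try lra; [apply Rmax_l|].
  apply (B_incl g); lra || easy.
Qed.

(** [g] places [x] in [C b]. Both norms are those of [B b], so in iterated estimates the semigroup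
    costs a factor and no scale. *)
Lemma Sg_bound g b t x : als <= g -> g < b -> b <= astar -> B g x ->
  nrm b (Sg t x) <= growth t * nrm b x.
Proof.
  intros H1 H2 H3 Hx. rewrite (Sg_eq g b) by easy.
  assert (Hbx : B b x) by (apply (B_incl g); lra || easy).
  assert (Hn : 0 <= nrm b x) by (apply (norm_ge0 _ _ _ (Ban b ltac:(lra))); easy).
  destruct HA2 as (_ & _ & _ & _ & Hnu & H).
  apply Rle_trans with (1 := H b (Rmax 0 t) x (inI_between b ltac:(lra)) (Rmax_l _ _)
    (B_in_C g b x H1 H2 H3 Hx)).
  apply Rmult_le_compat_r; [easy|]. unfold growth. apply Rmult_le_compat_l; [lra|].
  assert (Hw : omega * Rmax 0 t <= Rabs omega * Rmax 0 t)
    by (apply Rmult_le_compat_r; [apply Rmax_l|apply Rle_abs]).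
  destruct (Rle_lt_or_eq_dec _ _ Hw) as [Hlt | ->]; [|lra].
  now apply Rlt_le, exp_increasing.
Qed.

Lemma Sg_add g t x y : als <= g < astar -> B g x -> B g y ->
  Sg t (vadd x y) = vadd (Sg t x) (Sg t y).
Proof.
  intros Hg Hx Hy. destruct HA2 as (H & _).
  destruct (H astar Hastar) as (_ & _ & (_ & Hadd & _) & _).
  apply Hadd; [apply Rmax_l|apply (B_in_C g); lra || easy..].
Qed.

Lemma Sg_scal g t a x : als <= g < astar -> B g x -> Sg t (vscal a x) = vscal a (Sg t x).
Proof.
  intros Hg Hx. destruct HA2 as (H & _).
  destruct (H astar Hastar) as (_ & _ & (_ & _ & Hscal & _) & _).
  apply Hscal; [apply Rmax_l|apply (B_in_C g); lra || easy].
Qed.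

Lemma Sg_sub g t x y : als <= g < astar -> B g x -> B g y ->
  Sg t (vsub x y) = vsub (Sg t x) (Sg t y).
Proof.
  intros Hg Hx Hy. unfold vsub.
  assert (HB := Ban g ltac:(lra)).
  rewrite (Sg_add g) by (easy || now apply (ban_opp _ _ _ HB)).
  rewrite !vopp_scal. now rewrite (Sg_scal g).
Qed.

Lemma Sg_0 g t x : als <= g < astar -> B g x -> t <= 0 -> Sg t x = x.
Proof.
  intros Hg Hx Ht. unfold Sg. rewrite Rmax_left by easy. destruct HA2 as (H & _).
  destruct (H astar Hastar) as (_ & _ & (_ & _ & _ & _ & H0 & _) & _).
  apply H0, (B_in_C g); lra || easy.
Qed.

Lemma Sg_plus g t h x : als <= g < astar -> B g x -> 0 <= t -> 0 <= h ->
  Sg (t + h) x = Sg t (Sg h x).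
Proof.
  intros Hg Hx Ht Hh. unfold Sg. rewrite !Rmax_right by lra. destruct HA2 as (H & _).
  destruct (H astar Hastar) as (_ & _ & (_ & _ & _ & _ & _ & Hp & _) & _).
  apply Hp; try easy. apply (B_in_C g); lra || easy.
Qed.

Lemma Z_in g b x : als <= g -> g < b -> b <= astar -> B g x -> B b (Z x).
Proof.
  intros H1 H2 H3 Hx. destruct HA3 as (_ & _ & _ & _ & H).
  apply (H astar g b); try easy; lra.
Qed.

Lemma Z_bound g b x : als <= g -> g < b -> b <= astar -> B g x ->
  nrm b (Z x) <= (M astar / (b - g) + N astar) * nrm g x.
Proof.
  intros H1 H2 H3 Hx. destruct HA3 as (_ & _ & _ & _ & H).
  apply (H astar g b); try easy; lra.
Qed.

Lemma linear_on_sub (f : V -> V) g x y : linear_on (BI alo ahi B) f ->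
  als <= g <= astar -> B g x -> B g y -> f (vsub x y) = vsub (f x) (f y).
Proof.
  intros [H1 H2] Hg Hx Hy. unfold vsub. rewrite !vopp_scal, H1, H2; [easy|..];
    apply (B_BI g); try easy. now apply (ban_scal _ _ _ (Ban g Hg)).
Qed.

Lemma Z_sub g x y : als <= g <= astar -> B g x -> B g y -> Z (vsub x y) = vsub (Z x) (Z y).
Proof. apply linear_on_sub. apply HA3. Qed.

Lemma Aop_sub g x y :
  als <= g <= astar -> B g x -> B g y -> Aop (vsub x y) = vsub (Aop x) (Aop y).
Proof. apply linear_on_sub. apply HA2. Qed.

Lemma M_pos : 0 < M astar.
Proof. now apply HA3. Qed.

Lemma N_pos : 0 < N astar.
Proof. now apply HA3. Qed.

Lemma Z_const_pos g b : g < b -> 0 < M astar / (b - g) + N astar.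
Proof.
  intros H. assert (H1 := M_pos). assert (H2 := N_pos).
  assert (0 < M astar / (b - g)) by (apply Rdiv_lt_0_compat; lra). lra.
Qed.

(* For [x] in a smaller space the difference quotients converge, hence are
   bounded; uniform boundedness then makes the semigroup Lipschitz. *)
Lemma Sg_lip0 g b tau : als <= g -> g < b -> b <= astar ->
  exists K, 0 <= K /\ forall h x, 0 <= h <= tau -> B g x ->
    nrm b (vsub (Sg h x) x) <= K * h * nrm g x.
Proof.
  intros H1 H2 H3.
  assert (Bg := Ban g ltac:(lra)). assert (Bb := Ban b ltac:(lra)).
  assert (Hin : forall t x, B g x -> B g (vsub (Sg t x) x)).
  { intros t x Hx. apply (ban_sub _ _ _ Bg); [|easy]. apply Sg_in; [lra|easy]. }
  assert (Hinb : forall x, B g x -> B b x) by (intros; apply (B_incl g); lra || easy).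
  assert (Hquot : forall h x, 0 < h -> B g x ->
    nrm b (vscal (/ h) (vsub (Sg h x) x)) <= / h * ((growth h + 1) * nrm b x)).
  { intros h x Hh Hx. rewrite (norm_scal_eq _ _ _ Bb), Rabs_pos_eq by
      (auto || now apply Rlt_le, Rinv_0_lt_compat).
    apply Rmult_le_compat_l; [now apply Rlt_le, Rinv_0_lt_compat|].
    assert (T := norm_sub_le _ _ _ Bb (Sg h x) x (Hinb _ (Sg_in g h x ltac:(lra) Hx))
      (Hinb _ Hx)).
    assert (T2 := Sg_bound g b h x H1 H2 H3 Hx). lra. }
  (* Indexed by the step [h]: the crude bound [Hquot] holds for each [h] but degenerates as [h]
     tends to zero, where only pointwise convergence is known. *)
  destruct (uniform_boundedness V (B g) (B b) (nrm g) (nrm b) {h | 0 < h <= tau}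
    (fun h x => vscal (/ proj1_sig h) (vsub (Sg (proj1_sig h) x) x)) Bg Bb)
    as [K [HK0 HK]].
  - intros h x Hx. apply (ban_scal _ _ _ Bb). auto.
  - intros h x y Hx Hy. rewrite (Sg_add g) by (lra || easy). vec.
  - intros h a x Hx. rewrite (Sg_scal g) by (lra || easy). vec.
  - intros [h Hh]. simpl. exists (/ h * (growth h + 1)). intros x Hx.
    apply Rle_trans with (1 := Hquot h x (proj1 Hh) Hx). rewrite Rmult_assoc.
    apply Rmult_le_compat_l; [now apply Rlt_le, Rinv_0_lt_compat|].
    apply Rmult_le_compat_l; [assert (T := growth_ge1 h); lra|].
    apply nrm_anti; lra || easy.
  - intros x Hx. destruct HA2 as (H & _).
    destruct (H b (inI_between b ltac:(lra))) as (_ & _ & _ & _ & Hgen).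
    destruct (Hgen x (B_in_D g b x H1 H2 H3 Hx)) as [HAC Hlim].
    destruct (Hlim 1 Rlt_0_1) as [d [Hd Hdlim]].
    assert (HAB := C_in_B b _ ltac:(lra) HAC).
    assert (Hn0 := norm_ge0 _ _ _ Bb _ (Hinb _ Hx)).
    assert (HA0 := norm_ge0 _ _ _ Bb _ HAB).
    (* [K1] bounds the quotients with [d <= h <= tau]; for [h < d] they are within [1] of
       [Aop x]. *)
    set (K1 := / d * ((growth tau + 1) * nrm b x)).
    assert (HK1 : 0 <= K1).
    { apply Rmult_le_pos; [now apply Rlt_le, Rinv_0_lt_compat|].
      apply Rmult_le_pos; [assert (T := growth_ge1 tau)|]; lra. }
    exists (1 + nrm b (Aop x) + K1).
    intros [h [Hh Hht]]. simpl. destruct (Rlt_le_dec h d) as [Hhd|Hhd].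
    + specialize (Hdlim h (conj Hh Hhd)).
      assert (E : Sem b h x = Sg h x).
      { rewrite (Sg_eq g b) by easy. now rewrite Rmax_right by lra. }
      rewrite E in Hdlim.
      assert (T := norm_sub_ge _ _ _ Bb (vscal (/ h) (vsub (Sg h x) x)) (Aop x)
        (ban_scal _ _ _ Bb _ _ (Hinb _ (Hin _ _ Hx))) HAB). lra.
    + apply Rle_trans with K1; [|lra].
      apply Rle_trans with (1 := Hquot h x Hh Hx). unfold K1.
      assert (T := growth_ge1 h). assert (T2 := growth_mono h tau Hht).
      apply Rmult_le_compat; [now apply Rlt_le, Rinv_0_lt_compat| | |].
      * apply Rmult_le_pos; lra.
      * now apply Rinv_le_contravar.
      * apply Rmult_le_compat_r; lra.
  - exists K. split; [easy|]. intros h x [Hh Hht] Hx.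
    destruct (Rle_lt_or_eq_dec _ _ Hh) as [Hpos|<-].
    + specialize (HK (exist _ h (conj Hpos Hht)) x Hx). simpl in HK.
      rewrite (norm_scal_eq _ _ _ Bb), Rabs_pos_eq in HK by
        (auto || now apply Rlt_le, Rinv_0_lt_compat).
      apply (Rmult_le_compat_l h) in HK; [|easy].
      replace (h * (/ h * nrm b (vsub (Sg h x) x))) with (nrm b (vsub (Sg h x) x)) in HK
        by (field; lra). lra.
    + rewrite (Sg_0 g) by (lra || easy).
      replace (vsub x x) with (@vzero V) by vec. rewrite (norm_zero _ _ _ Bb). lra.
Qed.

(** For [t' <= t] the difference is [Sg t' (Sg (t - t') x - x)] after clamping both times at zero.
    The clamp is 1-Lipschitz, so negative times are covered as well. *)
Lemma Sg_lip g b tau : als <= g -> g < b -> b <= astar ->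
  exists K, 0 <= K /\ forall t t' x, t <= tau -> t' <= tau -> B g x ->
    nrm b (vsub (Sg t x) (Sg t' x)) <= K * Rabs (t - t') * nrm g x.
Proof.
  intros H1 H2 H3.
  assert (Bg := Ban g ltac:(lra)). assert (Bb := Ban b ltac:(lra)).
  destruct (Sg_lip0 g b (Rmax 0 tau) H1 H2 H3) as [K [HK0 HK]].
  assert (Hg := growth_ge1 tau).
  exists (growth tau * K). split; [apply Rmult_le_pos; lra|].
  assert (Hord : forall t t' x, t' <= t -> t <= tau -> B g x ->
    nrm b (vsub (Sg t x) (Sg t' x)) <= growth tau * K * Rabs (t - t') * nrm g x).
  { intros t t' x Ht' Ht Hx.
    set (p := Rmax 0 t'). set (h := Rmax 0 t - p).
    assert (Hp0 : 0 <= p) by apply Rmax_l.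
    assert (Hh0 : 0 <= h <= Rmax 0 tau).
    { unfold h, p, Rmax. repeat destruct (Rle_dec _ _); lra. }
    assert (Hh : h <= Rabs (t - t')).
    { apply Rle_trans with (2 := Rmax0_lip t t'). apply Rle_abs. }
    assert (E : vsub (Sg t x) (Sg t' x) = Sg p (vsub (Sg h x) x)).
    { rewrite (Sg_sub g) by (try apply Sg_in; lra || easy).
      rewrite <- (Sg_plus g) by (lra || easy). f_equal.
      - unfold Sg. f_equal. rewrite (Rmax_right 0 (p + h)) by lra. unfold h. ring.
      - unfold Sg. f_equal. now rewrite (Rmax_right 0 p). }
    rewrite E.
    assert (Hin : B g (vsub (Sg h x) x))
      by (apply (ban_sub _ _ _ Bg); [apply Sg_in; lra || easy|easy]).
    apply Rle_trans with (1 := Sg_bound g b p _ H1 H2 H3 Hin).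
    assert (Hn := norm_ge0 _ _ _ Bg x Hx).
    apply Rle_trans with (growth tau * (K * h * nrm g x)).
    - apply Rmult_le_compat.
      + assert (T := growth_ge1 p). lra.
      + apply (norm_ge0 _ _ _ Bb), (B_incl g); lra || easy.
      + unfold p, growth. rewrite (Rmax_right 0 (Rmax 0 t')) by apply Rmax_l.
        apply growth_mono. lra.
      + now apply HK.
    - rewrite !Rmult_assoc. apply Rmult_le_compat_l; [lra|].
      apply Rmult_le_compat_l; [lra|]. now apply Rmult_le_compat_r. }
  intros t t' x Ht Ht' Hx. destruct (Rle_lt_dec t' t) as [H|H].
  - now apply Hord.
  - rewrite (norm_sub_sym _ _ _ Bb), Rabs_minus_sym by
      (apply (B_incl g); try apply Sg_in; lra || easy).
    apply Hord; lra || easy.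
Qed.

Lemma Aop_in g x : als <= g < astar -> B g x -> B astar (Aop x).
Proof.
  intros Hg Hx. apply C_in_B; [lra|]. destruct HA2 as (H & _).
  destruct (H astar Hastar) as (_ & _ & _ & _ & Hgen).
  apply Hgen, (B_in_D g); lra || easy.
Qed.

Lemma Sg_deriv g x eps : als <= g < astar -> B g x -> 0 < eps ->
  exists delta, 0 < delta /\ forall h, 0 < h < delta ->
    nrm astar (vsub (vsub (Sg h x) x) (vscal h (Aop x))) <= eps * h.
Proof.
  intros Hg Hx He. destruct HA2 as (H & _).
  destruct (H astar Hastar) as (_ & _ & _ & _ & Hgen).
  destruct (Hgen x (B_in_D g astar x ltac:(lra) ltac:(lra) ltac:(lra) Hx)) as [_ Hlim].
  destruct (Hlim eps He) as [d [Hd Hdlim]]. exists d. split; [easy|].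
  intros h Hh. specialize (Hdlim h Hh).
  assert (Bs := Ban astar ltac:(lra)).
  replace (Sem astar h x) with (Sg h x) in Hdlim
    by (unfold Sg; now rewrite Rmax_right by lra).
  replace (vsub (vsub (Sg h x) x) (vscal h (Aop x))) with
    (vscal h (vsub (vscal (/ h) (vsub (Sg h x) x)) (Aop x))) by (vec_coef; field; lra).
  rewrite (norm_scal_eq _ _ _ Bs).
  - rewrite Rabs_pos_eq by lra. rewrite Rmult_comm. apply Rmult_le_compat_r; lra.
  - apply (ban_sub _ _ _ Bs); [|now apply (Aop_in g)].
    apply (ban_scal _ _ _ Bs), (B_incl g); try lra.
    apply (ban_sub _ _ _ (Ban g ltac:(lra))); [|easy]. now apply Sg_in.
Qed.

(** [Aop x] is the limit of difference quotients that are bounded by [K * nrm g x] with the same [K]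
    for all [x]. *)
Lemma Aop_bound g : als <= g < astar ->
  exists K, 0 <= K /\ forall x, B g x -> nrm astar (Aop x) <= K * nrm g x.
Proof.
  intros Hg. assert (Bs := Ban astar ltac:(lra)).
  destruct (Sg_lip0 g astar 1 ltac:(lra) ltac:(lra) ltac:(lra)) as [K [HK0 HK]].
  exists K. split; [easy|]. intros x Hx. apply le_epsilon. intros e He.
  destruct (Sg_deriv g x e Hg Hx He) as [d [Hd Hder]].
  set (h := Rmin (d / 2) 1).
  assert (Hh : 0 < h) by (apply Rmin_pos; lra).
  assert (Hhd : h <= d / 2) by apply Rmin_l. assert (Hh1 : h <= 1) by apply Rmin_r.
  specialize (Hder h ltac:(lra)). specialize (HK h x ltac:(lra) Hx).
  assert (HAx := Aop_in g x Hg Hx).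
  assert (Hdx : B astar (vsub (Sg h x) x)).
  { apply (B_incl g); try lra. apply (ban_sub _ _ _ (Ban g ltac:(lra))); [|easy].
    now apply Sg_in. }
  assert (Hhx := ban_scal _ _ _ Bs h _ HAx).
  rewrite (norm_sub_sym _ _ _ Bs) in Hder by easy.
  assert (T := norm_sub_ge _ _ _ Bs _ _ Hhx Hdx).
  rewrite (norm_scal_eq _ _ _ Bs), Rabs_pos_eq in T by (lra || easy).
  apply Rmult_le_reg_l with h; lra.
Qed.

(** * The Duhamel operator *)

(** The class in which the iteration takes place. Since all [b] of the open interval are demanded,
    it is stable under operators that lose scale: to reach [B b], use the hypothesis in [B g] with
    [g] halfway between [als] and [b]. It refers to the whole line because [vcontinuous] does. *)
Definition good (f : R -> V) : Prop :=
  forall b, als < b < astar -> (forall t, B b (f t)) /\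
    forall tau, exists K, 0 <= K /\
      (forall t, Rabs t <= tau -> nrm b (f t) <= K) /\
      (forall t t', Rabs t <= tau -> Rabs t' <= tau ->
        nrm b (vsub (f t) (f t')) <= K * Rabs (t - t')).

Lemma good_in f b t : good f -> als < b < astar -> B b (f t).
Proof. intros Hf Hb. now apply Hf. Qed.

Lemma good_continuous f b : good f -> als < b < astar -> vcontinuous (nrm b) f.
Proof.
  intros Hf Hb t0 eps He. destruct (Hf b Hb) as [_ H].
  destruct (H (Rabs t0 + 1)) as (K & HK0 & _ & HK).
  exists (Rmin 1 (eps / (K + 1))). split.
  { apply Rmin_pos; [lra|]. apply Rdiv_lt_0_compat; lra. }
  intros t Ht.
  assert (H1 : Rabs (t - t0) < 1) by (apply Rlt_le_trans with (1 := Ht), Rmin_l).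
  assert (H2 : Rabs (t - t0) < eps / (K + 1)) by (apply Rlt_le_trans with (1 := Ht), Rmin_r).
  assert (H3 : Rabs t <= Rabs t0 + 1).
  { replace t with (t0 + (t - t0)) by ring.
    apply Rle_trans with (1 := Rabs_triang _ _). lra. }
  apply Rle_lt_trans with (1 := HK t t0 H3 ltac:(lra)).
  apply (Rmult_lt_compat_l (K + 1)) in H2; [|lra].
  replace ((K + 1) * (eps / (K + 1))) with eps in H2 by (field; lra).
  assert (H4 := Rabs_pos (t - t0)). lra.
Qed.

Lemma good_add f g : good f -> good g -> good (fun t => vadd (f t) (g t)).
Proof.
  intros Hf Hg b Hb. assert (Bb := Ban b ltac:(lra)).
  destruct (Hf b Hb) as [Hfi Hfk]. destruct (Hg b Hb) as [Hgi Hgk]. split.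
  { intros t. now apply (ban_add _ _ _ Bb). }
  intros tau. destruct (Hfk tau) as (K & HK0 & HK & HKl).
  destruct (Hgk tau) as (K' & HK0' & HK' & HKl').
  exists (K + K'). split; [lra|]. split.
  - intros t Ht. apply Rle_trans with (1 := norm_add_le _ _ _ Bb _ _ (Hfi t) (Hgi t)).
    specialize (HK t Ht). specialize (HK' t Ht). lra.
  - intros t t' Ht Ht'.
    replace (vsub (vadd (f t) (g t)) (vadd (f t') (g t'))) with
      (vadd (vsub (f t) (f t')) (vsub (g t) (g t'))) by vec.
    assert (T := norm_add_le _ _ _ Bb _ _ (ban_sub _ _ _ Bb _ _ (Hfi t) (Hfi t'))
      (ban_sub _ _ _ Bb _ _ (Hgi t) (Hgi t'))).
    specialize (HKl t t' Ht Ht'). specialize (HKl' t t' Ht Ht'). lra.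
Qed.

Lemma good_opp f : good f -> good (fun t => vopp (f t)).
Proof.
  intros Hf b Hb. assert (Bb := Ban b ltac:(lra)). destruct (Hf b Hb) as [Hi Hk].
  split; [intros t; now apply (ban_opp _ _ _ Bb)|].
  intros tau. destruct (Hk tau) as (K & HK0 & HK & HKl).
  exists K. split; [easy|]. split.
  - intros t Ht. rewrite (norm_opp_eq _ _ _ Bb); auto.
  - intros t t' Ht Ht'.
    replace (vsub (vopp (f t)) (vopp (f t'))) with (vopp (vsub (f t) (f t'))) by vec.
    rewrite (norm_opp_eq _ _ _ Bb); auto. now apply (ban_sub _ _ _ Bb).
Qed.

Lemma good_Z f : good f -> good (fun t => Z (f t)).
Proof.
  intros Hf b Hb. set (g := (als + b) / 2). assert (Hg : als < g < b) by (unfold g; lra).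
  assert (Bg := Ban g ltac:(lra)). assert (Hc := Z_const_pos g b ltac:(lra)).
  destruct (Hf g ltac:(lra)) as [Hi Hk].
  split; [intros t; apply (Z_in g); lra || easy|].
  intros tau. destruct (Hk tau) as (K & HK0 & HK & HKl).
  exists ((M astar / (b - g) + N astar) * K). split; [apply Rmult_le_pos; lra|]. split.
  - intros t Ht.
    apply Rle_trans with (1 := Z_bound g b (f t) ltac:(lra) ltac:(lra) ltac:(lra) (Hi t)).
    apply Rmult_le_compat_l; [lra|auto].
  - intros t t' Ht Ht'. rewrite <- (Z_sub g) by (lra || easy).
    apply Rle_trans with (1 := Z_bound g b _ ltac:(lra) ltac:(lra) ltac:(lra)
      (ban_sub _ _ _ Bg _ _ (Hi t) (Hi t'))).
    rewrite Rmult_assoc. apply Rmult_le_compat_l; [lra|auto].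
Qed.

Lemma good_Sg : good (fun t => Sg t us).
Proof.
  intros b Hb. assert (Ba := Ban als ltac:(lra)).
  assert (Hn := norm_ge0 _ _ _ Ba us Hus).
  split; [intros t; apply (B_incl als); try apply Sg_in; lra || easy|].
  intros tau. destruct (Sg_lip als b tau ltac:(lra) ltac:(lra) ltac:(lra)) as (K & HK0 & HK).
  assert (Hg := growth_ge1 tau).
  exists (growth tau * nrm als us + K * nrm als us).
  assert (0 <= growth tau * nrm als us) by (apply Rmult_le_pos; lra).
  assert (0 <= K * nrm als us) by (apply Rmult_le_pos; lra).
  split; [lra|]. split.
  - intros t Ht. assert (Ht' : t <= tau) by (apply Rle_trans with (2 := Ht), Rle_abs).
    apply Rle_trans with (1 := Sg_bound als b t us ltac:(lra) ltac:(lra) ltac:(lra) Hus).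
    assert (growth t * nrm b us <= growth tau * nrm als us); [|lra].
    apply Rmult_le_compat.
    + assert (T := growth_ge1 t). lra.
    + apply (norm_ge0 _ _ _ (Ban b ltac:(lra))), (B_incl als); lra || easy.
    + now apply growth_mono.
    + apply nrm_anti; lra || easy.
  - intros t t' Ht Ht'.
    apply Rle_trans with (K * Rabs (t - t') * nrm als us).
    + apply HK; [| |easy]; eapply Rle_trans; try apply Rle_abs; easy.
    + assert (T := Rabs_pos (t - t')). nra.
Qed.

(** Product rule for differences: [Sg (t - r)] acts on [f r - f r'], and the variation of [Sg] acts
    on [f r']. The second part is where [Sg_lip] spends the gap from [g] to [b]. *)
Lemma good_conv f t : good f -> good (fun r => Sg (t - r) (f r)).
Proof.
  intros Hf b Hb. assert (Bb := Ban b ltac:(lra)).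
  set (g := (als + b) / 2). assert (Hg : als < g < b) by (unfold g; lra).
  assert (Bg := Ban g ltac:(lra)).
  destruct (Hf g ltac:(lra)) as [Hi Hk].
  assert (Hin : forall s x, B g x -> B b (Sg s x))
    by (intros; apply (B_incl g); try apply Sg_in; lra || easy).
  split; [auto|].
  intros tau. destruct (Hk tau) as (K & HK0 & HK & HKl).
  set (tau' := Rabs t + tau).
  destruct (Sg_lip g b tau' ltac:(lra) ltac:(lra) ltac:(lra)) as (K' & HK0' & HK').
  assert (Htau : forall r, Rabs r <= tau -> t - r <= tau').
  { intros r Hr. unfold tau'. assert (T := Rle_abs t). assert (T' := Rle_abs (- r)).
    rewrite Rabs_Ropp in T'. lra. }
  assert (Hgr := growth_ge1 tau').
  assert (Hop : forall r x, Rabs r <= tau -> B g x ->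
    nrm b (Sg (t - r) x) <= growth tau' * nrm g x).
  { intros r x Hr Hx.
    apply Rle_trans with (1 := Sg_bound g b (t - r) x ltac:(lra) ltac:(lra) ltac:(lra) Hx).
    apply Rmult_le_compat.
    + assert (T := growth_ge1 (t - r)). lra.
    + apply (norm_ge0 _ _ _ Bb), (B_incl g); lra || easy.
    + now apply growth_mono, Htau.
    + apply nrm_anti; lra || easy. }
  assert (P1 : 0 <= growth tau' * K) by (apply Rmult_le_pos; lra).
  assert (P2 : 0 <= K' * K) by (apply Rmult_le_pos; lra).
  exists (growth tau' * K + K' * K). split; [lra|]. split.
  - intros r Hr. apply Rle_trans with (1 := Hop r (f r) Hr (Hi r)).
    assert (growth tau' * nrm g (f r) <= growth tau' * K); [|lra].
    apply Rmult_le_compat_l; [lra|auto].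
  - intros r r' Hr Hr'.
    replace (vsub (Sg (t - r) (f r)) (Sg (t - r') (f r'))) with
      (vadd (Sg (t - r) (vsub (f r) (f r')))
        (vsub (Sg (t - r) (f r')) (Sg (t - r') (f r'))))
      by (rewrite (Sg_sub g) by (lra || easy); vec).
    assert (Hd := ban_sub _ _ _ Bg _ _ (Hi r) (Hi r')).
    assert (T := norm_add_le _ _ _ Bb _ _ (Hin (t - r) _ Hd)
      (ban_sub _ _ _ Bb _ _ (Hin (t - r) _ (Hi r')) (Hin (t - r') _ (Hi r')))).
    apply Rle_trans with (1 := T). rewrite Rmult_plus_distr_r. apply Rplus_le_compat.
    + apply Rle_trans with (1 := Hop r _ Hr Hd). rewrite Rmult_assoc.
      apply Rmult_le_compat_l; [lra|auto].
    + apply Rle_trans with (1 := HK' (t - r) (t - r') (f r') (Htau r Hr) (Htau r' Hr')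
        (Hi r')).
      replace (t - r - (t - r')) with (- (r - r')) by ring. rewrite Rabs_Ropp.
      assert (T2 := HK r' Hr'). assert (T3 := Rabs_pos (r - r')).
      assert (0 <= K' * Rabs (r - r')) by (apply Rmult_le_pos; lra).
      replace (K' * K * Rabs (r - r')) with (K' * Rabs (r - r') * K) by ring.
      now apply Rmult_le_compat_l.
Qed.

Lemma astar_le : als <= astar <= astar.
Proof. lra. Qed.

Definition Duh (f : R -> V) (t : R) : V :=
  vint (Ban astar astar_le) (fun r => Sg (t - r) (f r)) 0 t.

(** The inclusion of [B b] into [B astar] is a contraction and so commutes with the integral: the
    definition in the largest space serves for all [b]. *)
Lemma Duh_eq f b (Hb : als <= b <= astar) t : good f -> als < b < astar ->
  Duh f t = vint (Ban b Hb) (fun r => Sg (t - r) (f r)) 0 t.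
Proof.
  intros Hf Hb'. unfold Duh. assert (Hc := good_conv f t Hf).
  apply (vint_linear V (B b) (B astar) (nrm b) (nrm astar) (Ban b Hb) (Ban astar astar_le)
    (fun x => x) 1); try easy.
  - intros x Hx. apply (B_incl b); lra || easy.
  - intros x Hx. rewrite Rmult_1_l. apply nrm_anti; lra || easy.
  - intros r. exact (good_in _ b r Hc Hb').
  - exact (good_continuous _ b Hc Hb').
Qed.

Lemma Duh_in f b t : good f -> als < b < astar -> B b (Duh f t).
Proof.
  intros Hf Hb. assert (Hb' : als <= b <= astar) by lra.
  rewrite (Duh_eq f b Hb') by easy. apply vint_in.
Qed.

Lemma Duh_0 f : good f -> Duh f 0 = vzero.
Proof.
  intros Hf. set (b := (als + astar) / 2). assert (Hb : als < b < astar) by (unfold b; lra).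
  assert (Hb' : als <= b <= astar) by lra.
  rewrite (Duh_eq f b Hb') by easy. assert (Hc := good_conv f 0 Hf).
  assert (E := vint_chasles _ _ _ (Ban b Hb') (fun r => Sg (0 - r) (f r))
    (fun r => good_in _ b r Hc Hb) (good_continuous _ b Hc Hb) 0 0 0).
  set (y := vint _ _ _ _) in *.
  transitivity (vsub (vadd y y) y); [|rewrite <- E]; vec.
Qed.

(** On [[0, t]] the semigroup law writes [Sg (t + h - r)] as [Sg h] after [Sg (t - r)], and [Sg h]
    leaves the integral as a bounded map from [B g] to [B b]. Time regularity of [Duh] and of the
    solution rests on this identity. *)
Lemma Duh_step f b (Hb : als <= b <= astar) t h : good f -> als < b < astar ->
  0 <= t -> 0 <= h ->
  Duh f (t + h) = vadd (Sg h (Duh f t))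
    (vint (Ban b Hb) (fun r => Sg (t + h - r) (f r)) t (t + h)).
Proof.
  intros Hf Hb' Ht Hh. rewrite (Duh_eq f b Hb) by easy.
  assert (Hc := good_conv f (t + h) Hf).
  rewrite (vint_chasles _ _ _ (Ban b Hb) (fun r => Sg (t + h - r) (f r))
    (fun r => good_in _ b r Hc Hb') (good_continuous _ b Hc Hb') 0 t (t + h)).
  f_equal. set (g := (als + b) / 2). assert (Hg : als < g < b) by (unfold g; lra).
  assert (Hg1 : als <= g <= astar) by lra. assert (Hg2 : als < g < astar) by lra.
  rewrite (Duh_eq f g Hg1) by easy. assert (Hct := good_conv f t Hf).
  rewrite <- (vint_linear V (B g) (B b) (nrm g) (nrm b) (Ban g Hg1) (Ban b Hb)
    (Sg h) (growth h)).
  - apply vint_ext; [easy|]. intros r Hr.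
    replace (t + h - r) with (h + (t - r)) by ring.
    apply (Sg_plus g); try lra. now apply good_in.
  - intros x Hx. apply (B_incl g); try apply Sg_in; lra || easy.
  - intros x y. apply Sg_add. lra.
  - intros a x. apply Sg_scal. lra.
  - intros x Hx.
    apply Rle_trans with (1 := Sg_bound g b h x ltac:(lra) ltac:(lra) ltac:(lra) Hx).
    apply Rmult_le_compat_l; [assert (T := growth_ge1 h); lra|].
    apply nrm_anti; lra || easy.
  - intros r. exact (good_in _ g r Hct Hg2).
  - exact (good_continuous _ g Hct Hg2).
Qed.

Lemma Duh_sub f f' t : good f -> good f' ->
  vsub (Duh f t) (Duh f' t) = Duh (fun r => vsub (f r) (f' r)) t.
Proof.
  intros Hf Hf'. assert (Hd : good (fun r => vsub (f r) (f' r)))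
    by (apply (good_add f (fun r => vopp (f' r))); [|apply good_opp]; easy).
  set (b := (als + astar) / 2). assert (Hb : als < b < astar) by (unfold b; lra).
  assert (Hb' : als <= b <= astar) by lra. rewrite !(Duh_eq _ b Hb') by easy.
  assert (Hc := good_conv f t Hf). assert (Hc' := good_conv f' t Hf').
  rewrite <- vint_sub.
  - f_equal. apply functional_extensionality. intros r.
    symmetry. apply (Sg_sub b); try lra; now apply good_in.
  - intros r. exact (good_in _ b r Hc Hb).
  - intros r. exact (good_in _ b r Hc' Hb).
  - exact (good_continuous _ b Hc Hb).
  - exact (good_continuous _ b Hc' Hb).
Qed.

Lemma Duh_norm_le f b t G : good f -> als < b < astar -> 0 <= t ->
  (forall r, 0 <= r <= t -> nrm b (Sg (t - r) (f r)) <= G r) -> ex_RInt G 0 t ->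
  nrm b (Duh f t) <= RInt G 0 t.
Proof.
  intros Hf Hb Ht HG Hex. assert (Hb' : als <= b <= astar) by lra.
  rewrite (Duh_eq f b Hb') by easy. assert (Hc := good_conv f t Hf).
  apply vint_norm_le; try easy.
  - intros r. exact (good_in _ b r Hc Hb).
  - exact (good_continuous _ b Hc Hb).
Qed.

(** By [Duh_step], an increment over time [h] consists of an integral over [[t', t' + h]] with
    bounded integrand and of [Sg h - 1] applied to [Duh f t']. The latter is of order [h] in [B b]
    because [Duh f t'] is bounded in the smaller [B g]. *)
Lemma good_Duh f : good f -> good (fun t => Duh f (Rmax 0 t)).
Proof.
  intros Hf.
  assert (Hbd : forall b tau, als < b < astar -> 0 <= tau -> exists K, 0 <= K /\
    forall t r, 0 <= r <= t -> t <= tau -> nrm b (Sg (t - r) (f r)) <= K).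
  { intros b tau Hb Htau. assert (Bb := Ban b ltac:(lra)).
    set (g := (als + b) / 2). assert (Hg : als < g < b) by (unfold g; lra).
    destruct (Hf g ltac:(lra)) as [Hi Hk]. destruct (Hk tau) as (K & HK0 & HK & _).
    assert (Hgr := growth_ge1 tau).
    exists (growth tau * K). split; [apply Rmult_le_pos; lra|]. intros t r Hr Ht.
    apply Rle_trans with
      (1 := Sg_bound g b (t - r) _ ltac:(lra) ltac:(lra) ltac:(lra) (Hi r)).
    apply Rmult_le_compat.
    - assert (T := growth_ge1 (t - r)). lra.
    - apply (norm_ge0 _ _ _ Bb), (B_incl g); lra || easy.
    - apply growth_mono. lra.
    - apply Rle_trans with (nrm g (f r)); [apply nrm_anti; lra || easy|].
      apply HK. rewrite Rabs_pos_eq; lra. }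
  assert (Hbound : forall b tau, als < b < astar -> 0 <= tau -> exists K, 0 <= K /\
    forall t, 0 <= t <= tau -> nrm b (Duh f t) <= K).
  { intros b tau Hb Htau. destruct (Hbd b tau Hb Htau) as [K [HK0 HK]].
    exists (tau * K). split; [now apply Rmult_le_pos|]. intros t Ht.
    apply Rle_trans with (RInt (fun _ => K) 0 t).
    - apply Duh_norm_le; try easy.
      + intros r Hr. now apply HK.
      + apply ex_RInt_const.
    - rewrite RInt_const. apply Rmult_le_compat_r; lra. }
  intros b Hb. assert (Bb := Ban b ltac:(lra)). split; [intros t; now apply Duh_in|].
  intros tau0. set (tau := Rmax 0 tau0). assert (Htau : 0 <= tau) by apply Rmax_l.
  set (g := (als + b) / 2). assert (Hg : als < g < b) by (unfold g; lra).
  destruct (Hbd b tau Hb Htau) as [K1 [HK1 HK1b]].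
  destruct (Hbound b tau Hb Htau) as [K2 [HK2 HK2b]].
  destruct (Hbound g tau ltac:(lra) Htau) as [K3 [HK3 HK3b]].
  destruct (Sg_lip0 g b tau ltac:(lra) ltac:(lra) ltac:(lra)) as [K4 [HK4 HK4b]].
  assert (P34 : 0 <= K4 * K3) by now apply Rmult_le_pos.
  assert (Hmax : forall t, Rabs t <= tau0 -> 0 <= Rmax 0 t <= tau).
  { intros t Ht. assert (T := Rle_abs t). unfold tau, Rmax.
    repeat destruct (Rle_dec _ _); lra. }
  assert (Hord : forall t t', 0 <= t' <= t -> t <= tau ->
    nrm b (vsub (Duh f t) (Duh f t')) <= (K1 + K4 * K3) * (t - t')).
  { intros t t' Ht' Ht. set (h := t - t').
    assert (Hb' : als <= b <= astar) by lra.
    assert (Hd' : B g (Duh f t')) by (apply Duh_in; easy || lra).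
    assert (Hd : forall s, B b (Duh f s)) by (intros; apply Duh_in; easy || lra).
    assert (Hsg : B b (Sg h (Duh f t'))) by (apply (B_incl g); try apply Sg_in; lra || easy).
    assert (E := Duh_step f b Hb' t' h Hf Hb ltac:(lra) ltac:(unfold h; lra)).
    replace (t' + h) with t in E by (unfold h; ring).
    set (I := vint _ _ _ _) in E.
    assert (HI : B b I) by apply vint_in.
    assert (HIn : nrm b I <= K1 * h).
    { assert (Hc := good_conv f t Hf). unfold I.
      apply Rle_trans with (RInt (fun _ => K1) t' t).
      - apply vint_norm_le.
        + intros r. exact (good_in _ b r Hc Hb).
        + exact (good_continuous _ b Hc Hb).
        + lra.
        + intros r Hr. apply HK1b; lra.
        + apply ex_RInt_const.
      - rewrite RInt_const. apply Req_le. unfold scal; simpl; unfold mult; simpl.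
        unfold h. ring. }
    rewrite E.
    replace (vsub (vadd (Sg h (Duh f t')) I) (Duh f t')) with
      (vadd I (vsub (Sg h (Duh f t')) (Duh f t'))) by vec.
    assert (T := norm_add_le _ _ _ Bb I _ HI (ban_sub _ _ _ Bb _ _ Hsg (Hd t'))).
    assert (T2 := HK4b h _ ltac:(unfold h; lra) Hd').
    assert (T3 := HK3b t' ltac:(lra)).
    assert (T4 : K4 * h * nrm g (Duh f t') <= K4 * h * K3).
    { apply Rmult_le_compat_l; [apply Rmult_le_pos; unfold h; lra|easy]. }
    lra. }
  exists (K2 + (K1 + K4 * K3)). split; [lra|]. split.
  - intros t Ht. specialize (HK2b _ (Hmax t Ht)). lra.
  - intros t t' Ht Ht'.
    apply Rle_trans with ((K1 + K4 * K3) * Rabs (Rmax 0 t - Rmax 0 t')).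
    + destruct (Rle_lt_dec (Rmax 0 t') (Rmax 0 t)) as [H|H].
      * rewrite Rabs_pos_eq by lra. apply Hord.
        -- split; [apply Rmax_l|easy].
        -- now apply Hmax.
      * rewrite (norm_sub_sym _ _ _ Bb), Rabs_minus_sym by now apply Duh_in.
        rewrite Rabs_pos_eq by lra. apply Hord.
        -- split; [apply Rmax_l|lra].
        -- now apply Hmax.
    + assert (T := Rmax0_lip t t'). assert (T2 := Rabs_pos (Rmax 0 t - Rmax 0 t')).
      apply Rmult_le_compat; lra.
Qed.

(** * Picard iteration *)

(** Started from zero, so that the first difference is the free orbit [Sg t us] and one formula
    covers all differences. *)
Fixpoint pic (k : nat) (t : R) : V :=
  match k with
  | O => vzero
  | S k => vadd (Sg t us) (Duh (fun r => Z (pic k r)) (Rmax 0 t))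
  end.

Lemma good_pic k : good (pic k).
Proof.
  induction k as [|k IH].
  - intros b Hb. assert (Bb := Ban b ltac:(lra)).
    split; [intros t; apply (ban_0 _ _ _ Bb)|]. intros tau. exists 0.
    split; [lra|]. split.
    + intros t _. simpl. rewrite (norm_zero _ _ _ Bb). lra.
    + intros t t' _ _. simpl. replace (vsub vzero vzero) with (@vzero V) by vec.
      rewrite (norm_zero _ _ _ Bb). lra.
  - apply (good_add (fun t => Sg t us) (fun t => Duh (fun r => Z (pic k r)) (Rmax 0 t))).
    + apply good_Sg.
    + now apply good_Duh, good_Z.
Qed.

Lemma is_RInt_pow_fact k K t :
  is_RInt (fun r => K * (r ^ k / INR (fact k))) 0 t (K * (t ^ S k / INR (fact (S k)))).
Proof.
  rewrite fact_simpl, mult_INR.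
  assert (Hc := INR_fact_neq_0 k). revert Hc. generalize (INR (fact k)). intros c Hc.
  assert (Hk : INR (S k) <> 0) by now apply not_0_INR.
  set (F := fun r => K * (r ^ S k / (INR (S k) * c))).
  replace (K * (t ^ S k / (INR (S k) * c))) with (minus (F t) (F 0)).
  - apply (is_RInt_derive F).
    + intros r _. unfold F. auto_derive; [easy|]. field. easy.
    + intros r _. apply (ex_derive_continuous (V := R_NormedModule)). auto_derive. easy.
  - unfold F, minus, plus, opp; simpl. field. easy.
Qed.

(** The gap [d] stays fixed along the induction, which descends from [b] to [b - d]; it is chosen in
    terms of [k] only afterwards. Exponential factors of successive semigroups multiply to a single
    [exp (Rabs omega * t)], whereas [nu] is collected once per semigroup. *)
Lemma pic_diff k : forall b d t, 0 < d -> als + INR k * d < b -> b < astar -> 0 <= t ->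
  nrm b (vsub (pic (S k) t) (pic k t)) <=
  nu * (nu * (M astar / d + N astar)) ^ k * exp (Rabs omega * t) *
    nrm als us * (t ^ k / INR (fact k)).
Proof.
  assert (Hnu := nu_ge1).
  assert (HU := norm_ge0 _ _ _ (Ban als ltac:(lra)) us Hus).
  induction k as [|k IH]; intros b d t Hd Hb1 Hb2 Ht.
  - rewrite Rmult_0_l, Rplus_0_r in Hb1.
    assert (Bb := Ban b ltac:(lra)).
    assert (HG : good (fun _ : R => Z vzero)) by (apply (good_Z (pic 0)), (good_pic 0)).
    assert (HZ0 : Z vzero = vzero).
    { assert (E := Z_sub als us us ltac:(lra) Hus Hus).
      replace (vsub us us) with (@vzero V) in E by vec. rewrite E. vec. }
    (* The zero integrand is written as a difference, so that [Duh_sub] makes its integral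
       vanish. *)
    assert (HD : Duh (fun _ => Z vzero) (Rmax 0 t) = vzero).
    { transitivity (Duh (fun r => vsub (Z (@vzero V)) (Z vzero)) (Rmax 0 t)).
      - f_equal. apply functional_extensionality. intros r. rewrite HZ0. vec.
      - rewrite <- (Duh_sub (fun _ => Z vzero) (fun _ => Z vzero)) by easy. vec. }
    simpl. rewrite HD. replace (vsub (vadd (Sg t us) vzero) vzero) with (Sg t us) by vec.
    apply Rle_trans with (1 := Sg_bound als b t us ltac:(lra) ltac:(lra) ltac:(lra) Hus).
    unfold growth. rewrite Rmax_right by easy.
    assert (T := nrm_anti als b us ltac:(lra) ltac:(lra) ltac:(lra) Hus).
    assert (T2 := exp_pos (Rabs omega * t)).
    replace (nu * 1 * exp (Rabs omega * t) * nrm als us * (1 / 1)) with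
      (nu * exp (Rabs omega * t) * nrm als us) by field.
    apply Rmult_le_compat_l; [apply Rmult_le_pos; lra|easy].
  - set (b' := b - d). rewrite S_INR in Hb1.
    assert (Hk := pos_INR k). assert (Hkd : 0 <= INR k * d) by (apply Rmult_le_pos; lra).
    assert (Hb' : als + INR k * d < b') by (unfold b'; lra).
    set (c := M astar / d + N astar).
    assert (Hc : 0 < c).
    { unfold c. replace d with (b - b') by (unfold b'; ring).
      apply Z_const_pos. unfold b'. lra. }
    set (x := fun r => vsub (pic (S k) r) (pic k r)).
    assert (Hx : forall g r, als < g < astar -> B g (x r)).
    { intros g r Hg. apply (ban_sub _ _ _ (Ban g ltac:(lra)));
        apply good_in; try apply good_pic; easy. }
    assert (HZg : forall j, good (fun r => Z (pic j r))) by (intros; apply good_Z, good_pic).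
    assert (E : vsub (pic (S (S k)) t) (pic (S k) t) = Duh (fun r => Z (x r)) t).
    { change (pic (S (S k)) t) with
        (vadd (Sg t us) (Duh (fun r => Z (pic (S k) r)) (Rmax 0 t))).
      change (pic (S k) t) with
        (vadd (Sg t us) (Duh (fun r => Z (pic k r)) (Rmax 0 t))).
      rewrite Rmax_right by easy.
      transitivity (vsub (Duh (fun r => Z (pic (S k) r)) t) (Duh (fun r => Z (pic k r)) t));
        [vec|].
      rewrite Duh_sub by easy. f_equal. apply functional_extensionality. intros r.
      symmetry. apply (Z_sub b'); [unfold b'; lra|..]; apply good_in; try apply good_pic;
        unfold b'; lra. }
    rewrite E.
    set (A := nu * (nu * c) ^ k).
    set (K := nu * c * A * exp (Rabs omega * t) * nrm als us).
    assert (HI := is_RInt_pow_fact k K t).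
    replace (nu * (nu * c) ^ S k * exp (Rabs omega * t) * nrm als us *
      (t ^ S k / INR (fact (S k)))) with (K * (t ^ S k / INR (fact (S k))))
      by (unfold K, A; simpl; ring).
    rewrite <- (is_RInt_unique _ _ _ _ HI).
    assert (HZx : good (fun r => Z (x r))).
    { apply good_Z. apply (good_add (pic (S k)) (fun r => vopp (pic k r))).
      - apply good_pic.
      - apply good_opp, good_pic. }
    apply Duh_norm_le; try easy; [lra| |now exists (K * (t ^ S k / INR (fact (S k))))].
    intros r Hr.
    (* The semigroup bound in [B b] wants [Z (x r)] in a strictly smaller space, for which
       [b - d / 2] serves; the norm of [Z (x r)] is still estimated over the full gap [d]. *)
    assert (Hb0 : b' < b - d / 2 < b) by (unfold b'; lra).
    assert (HZb : B (b - d / 2) (Z (x r))).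
    { apply (good_in _ _ r HZx). unfold b' in *; lra. }
    apply Rle_trans with
      (1 := Sg_bound (b - d / 2) b (t - r) _ ltac:(lra) ltac:(lra) ltac:(lra) HZb).
    assert (HZn := Z_bound b' b (x r) ltac:(lra) ltac:(lra) ltac:(lra)
      (Hx b' r ltac:(unfold b' in *; lra))).
    replace (b - b') with d in HZn by (unfold b'; ring). fold c in HZn.
    specialize (IH b' d r Hd Hb' ltac:(lra) ltac:(lra)). fold c in IH. fold A in IH.
    fold (x r) in IH.
    unfold growth. rewrite Rmax_right by lra.
    assert (Hex : exp (Rabs omega * t) = exp (Rabs omega * (t - r)) * exp (Rabs omega * r)).
    { rewrite <- exp_plus. f_equal. ring. }
    set (e1 := exp (Rabs omega * (t - r))) in *. set (e2 := exp (Rabs omega * r)) in *.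
    assert (He1 : 0 < e1) by apply exp_pos.
    replace (K * (r ^ k / INR (fact k))) with
      (nu * e1 * (c * (A * e2 * nrm als us * (r ^ k / INR (fact k)))))
      by (unfold K; rewrite Hex; ring).
    apply Rmult_le_compat_l; [apply Rmult_le_pos; lra|].
    apply Rle_trans with (1 := HZn). apply Rmult_le_compat_l; lra.
Qed.

Lemma exp_INR k : exp (INR k) = exp 1 ^ k.
Proof.
  induction k as [|k IH]; [apply exp_0|].
  rewrite S_INR, exp_plus, IH. simpl. ring.
Qed.

(** [tau] is below the lifetime with [astar] replaced by [b] in the numerator of [Tdef] but kept in
    [M astar]; stated without division. *)
Definition within (b tau : R) : Prop :=
  als < b < astar /\ 0 <= tau /\ exp 1 * nu * M astar * tau < b - als.

(* Splitting [(als, b)] into [k + 1] equal steps in [pic_diff] gives a factor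
   [(k + 1 + beta) ^ k / k!], which is at most [exp (k + 1 + beta)]. *)
Lemma pic_geometric b tau : within b tau ->
  exists K q, 0 <= q < 1 /\ forall k t, 0 <= t <= tau ->
    nrm b (vsub (pic (S k) t) (pic k t)) <= K * q ^ k.
Proof.
  intros (Hb & Htau & Hlt).
  set (L := b - als). assert (HL : 0 < L) by (unfold L; lra).
  assert (HM := M_pos). assert (HN := N_pos). assert (Hnu := nu_ge1).
  assert (HU := norm_ge0 _ _ _ (Ban als ltac:(lra)) us Hus).
  set (U := nrm als us) in *. set (m := M astar) in *.
  (* With [d = L / (k + 1)], the cost of one iteration factors as [nu * m / L * (k + 1 + beta)].
     Thus [N] becomes a shift, which ends up in the constant [exp (1 + beta)] and not in the
     ratio. *)
  set (beta := N astar * L / m).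
  assert (Hbeta : 0 < beta) by (unfold beta; apply Rdiv_lt_0_compat; nra).
  set (q0 := nu * m * tau / L).
  assert (Hq0 : 0 <= q0).
  { unfold q0, Rdiv. repeat apply Rmult_le_pos; try lra.
    now apply Rlt_le, Rinv_0_lt_compat. }
  assert (He := exp_pos 1).
  set (W := exp (Rabs omega * tau)). assert (HW : 0 < W) by apply exp_pos.
  (* The factor [exp 1] in the ratio comes from [exp (k + 1 + beta)]; that the ratio is below [1] is
     the inequality in [within]. *)
  exists (nu * W * U * exp (1 + beta)), (exp 1 * q0). split.
  { split; [apply Rmult_le_pos; lra|]. unfold q0.
    replace (exp 1 * (nu * m * tau / L)) with ((exp 1 * nu * m * tau) / L) by (field; lra).
    apply Rmult_lt_reg_r with L; [easy|].
    replace (exp 1 * nu * m * tau / L * L) with (exp 1 * nu * m * tau) by (field; lra).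
    fold L in Hlt. lra. }
  intros k t Ht. assert (Hk := pos_INR k).
  (* [k + 1] parts for [k] applications of [Z]: the spare part gives the strict inequality required
     by [pic_diff]. *)
  set (d := L / (INR k + 1)).
  assert (Hd : 0 < d) by (unfold d; apply Rdiv_lt_0_compat; lra).
  assert (Hkd : als + INR k * d < b).
  { assert (E : INR k * d + d = L) by (unfold d; field; lra). unfold L in E. lra. }
  apply Rle_trans with (1 := pic_diff k b d t Hd Hkd (proj2 Hb) (proj1 Ht)).
  fold U m. set (y := INR k + 1 + beta).
  replace (nu * (m / d + N astar)) with (nu * m / L * y)
    by (unfold y, d, beta; field; lra).
  assert (Hy := pow_fact_le_exp y k ltac:(unfold y; lra)).
  assert (Hey : exp y = exp (1 + beta) * exp 1 ^ k).
  { rewrite <- exp_INR, <- exp_plus. f_equal. unfold y. ring. }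
  assert (Hex : exp (Rabs omega * t) <= W).
  { unfold W. assert (Rabs omega * t <= Rabs omega * tau)
      by (apply Rmult_le_compat_l; [apply Rabs_pos|lra]).
    destruct (Req_dec (Rabs omega * t) (Rabs omega * tau)) as [->|]; [lra|].
    apply Rlt_le, exp_increasing. lra. }
  assert (Htk : t ^ k <= tau ^ k) by now apply pow_incr.
  assert (Htk0 : 0 <= t ^ k) by now apply pow_le.
  assert (Hp : 0 <= nu * m / L) by (apply Rlt_le, Rdiv_lt_0_compat; nra).
  assert (Hpk : 0 <= (nu * m / L) ^ k) by now apply pow_le.
  assert (Hf : 0 < INR (fact k)) by apply INR_fact_lt_0.
  assert (Hf' : 0 < / INR (fact k)) by now apply Rinv_0_lt_compat.
  assert (Hyk : 0 <= y ^ k) by (apply pow_le; unfold y; lra).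
  apply Rle_trans with (nu * U * (nu * m / L) ^ k * (W * tau ^ k) * (y ^ k / INR (fact k))).
  - rewrite Rpow_mult_distr.
    replace (nu * ((nu * m / L) ^ k * y ^ k) * exp (Rabs omega * t) * U * (t ^ k / INR (fact k)))
      with (nu * U * (nu * m / L) ^ k * (exp (Rabs omega * t) * t ^ k) * (y ^ k / INR (fact k)))
      by (unfold Rdiv; ring).
    apply Rmult_le_compat_r; [apply Rmult_le_pos; lra|].
    apply Rmult_le_compat_l; [repeat apply Rmult_le_pos; lra|].
    apply Rmult_le_compat; try lra. apply Rlt_le, exp_pos.
  - replace (nu * W * U * exp (1 + beta) * (exp 1 * q0) ^ k) with
      (nu * U * (nu * m / L) ^ k * (W * tau ^ k) * exp y).
    + apply Rmult_le_compat_l; [|easy].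
      assert (0 <= tau ^ k) by now apply pow_le. repeat apply Rmult_le_pos; lra.
    + rewrite Hey. unfold q0.
      replace (exp 1 * (nu * m * tau / L)) with (exp 1 * (nu * m / L * tau)) by (field; lra).
      rewrite !Rpow_mult_distr. ring.
Qed.

(** * The solution *)

(** Convergence is asked for in the largest space, which makes the choice independent of [b]; where
    the iterates diverge the value is unspecified. *)
Definition sol (t : R) : V :=
  epsilon (inhabits vzero)
    (fun l => B astar l /\ seq_conv (nrm astar) (fun k => pic k t) l).

Lemma pic_in k b t : als < b < astar -> B b (pic k t).
Proof. apply good_in, good_pic. Qed.

(** The limit formed in [B b] is also a limit in [B astar], and uniqueness there identifies it with
    [sol t]. The rate is uniform in [t], so estimates pass from the iterates to [sol]. *)
Lemma sol_approx b tau : within b tau ->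
  exists K q, 0 <= q < 1 /\ forall k t, 0 <= t <= tau ->
    B b (sol t) /\ nrm b (vsub (sol t) (pic k t)) <= K * q ^ k.
Proof.
  intros Hw. assert (Hb := proj1 Hw).
  destruct (pic_geometric b tau Hw) as (K & q & Hq & HK).
  exists (K / (1 - q)), q. split; [easy|]. intros k t Ht.
  assert (Bb := Ban b ltac:(lra)). assert (Bs := Ban astar ltac:(lra)).
  destruct (geometric_limit _ _ _ Bb (fun k => pic k t) K q) as (l & Hl & Hconv & Hle).
  { intros j. now apply pic_in. }
  { easy. }
  { intros j. now apply HK. }
  assert (Hls : B astar l) by (apply (B_incl b); lra || easy).
  assert (Hconvs : seq_conv (nrm astar) (fun k => pic k t) l).
  { intros e He. destruct (Hconv e He) as [j0 Hj]. exists j0. intros j Hj0.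
    apply Rle_lt_trans with (2 := Hj j Hj0). apply nrm_anti; try lra.
    apply (ban_sub _ _ _ Bb); [now apply pic_in|easy]. }
  assert (Hspec : B astar (sol t) /\ seq_conv (nrm astar) (fun k => pic k t) (sol t))
    by (apply (epsilon_spec (inhabits vzero)
      (fun l => B astar l /\ seq_conv (nrm astar) (fun k => pic k t) l)); now exists l).
  assert (E : sol t = l).
  { apply (seq_conv_unique _ _ _ Bs (fun k => pic k t)); try easy.
    intros j. apply (B_incl b); try lra. now apply pic_in. }
  rewrite E. split; [easy|apply Hle].
Qed.

Lemma sol_in b tau t : within b tau -> 0 <= t <= tau -> B b (sol t).
Proof.
  intros Hw Ht. destruct (sol_approx b tau Hw) as (K & q & _ & H). now apply (H O).
Qed.

Lemma sol_continuous b tau t0 eps : within b tau -> 0 <= t0 <= tau -> 0 < eps ->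
  exists delta, 0 < delta /\ forall t, 0 <= t <= tau -> Rabs (t - t0) < delta ->
    nrm b (vsub (sol t) (sol t0)) < eps.
Proof.
  intros Hw Ht0 He. assert (Hb := proj1 Hw). assert (Bb := Ban b ltac:(lra)).
  destruct (sol_approx b tau Hw) as (K & q & Hq & HK).
  destruct (geometric_small K q (eps / 3) Hq ltac:(lra)) as [k Hk].
  specialize (Hk k (le_n k)).
  destruct (good_continuous _ b (good_pic k) Hb t0 (eps / 3) ltac:(lra)) as [d [Hd Hdc]].
  exists d. split; [easy|]. intros t Ht Htd. specialize (Hdc t Htd).
  destruct (HK k t Ht) as [Hi H1]. destruct (HK k t0 Ht0) as [Hi0 H2].
  assert (Hp := pic_in k b t Hb). assert (Hp0 := pic_in k b t0 Hb).
  assert (T1 := norm_dist_tri _ _ _ Bb _ _ _ Hi Hp Hi0).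
  assert (T2 := norm_dist_tri _ _ _ Bb _ _ _ Hp Hp0 Hi0).
  rewrite (norm_sub_sym _ _ _ Bb) in H2 by easy. lra.
Qed.

Lemma sol_0 : sol 0 = us.
Proof.
  set (b := (als + astar) / 2). assert (Hb : als < b < astar) by (unfold b; lra).
  assert (Hw : within b 0) by (repeat split; lra).
  assert (Bb := Ban b ltac:(lra)).
  destruct (sol_approx b 0 Hw) as (K & q & Hq & HK).
  assert (Hpic : forall k, pic (S k) 0 = us).
  { intros k. simpl. rewrite Rmax_left by lra. rewrite Duh_0 by apply good_Z, good_pic.
    rewrite (Sg_0 als) by (lra || easy). vec. }
  assert (Hs : B b (sol 0)) by (apply (sol_in b 0); easy || lra).
  assert (Hu : B b us) by (apply (B_incl als); lra || easy).
  assert (Hd := ban_sub _ _ _ Bb _ _ Hs Hu).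
  assert (E : nrm b (vsub (sol 0) us) = 0).
  { apply Rle_antisym; [|now apply (norm_ge0 _ _ _ Bb)].
    apply (le_geometric_limit _ 0 (K * q) q Hq). intros k.
    destruct (HK (S k) 0 ltac:(lra)) as [_ H]. rewrite Hpic in H. simpl in H. lra. }
  apply Bb in E; [|easy].
  transitivity (vadd (vsub (sol 0) us) us); [vec|]. rewrite E. vec.
Qed.

Lemma pic_step k b (Hb : als <= b <= astar) t h : als < b < astar -> 0 <= t -> 0 <= h ->
  pic (S k) (t + h) = vadd (Sg h (pic (S k) t))
    (vint (Ban b Hb) (fun r => Sg (t + h - r) (Z (pic k r))) t (t + h)).
Proof.
  intros Hb' Ht Hh. assert (HZ : good (fun r => Z (pic k r))) by apply good_Z, good_pic.
  simpl. rewrite !Rmax_right by lra.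
  rewrite (Duh_step _ b Hb) by easy.
  rewrite (Sg_add b) by (try apply Duh_in;
    try (apply (B_incl als); try apply Sg_in); lra || easy).
  rewrite <- (Sg_plus als) by (lra || easy). rewrite (Rplus_comm h t). vec.
Qed.

(** The perturbation is frozen at [t0] while the step starts at any nearby [t]. This covers the
    steps out of [t0] and those that arrive at [t0], hence both one-sided derivatives. *)
Lemma sol_step b tau b' t0 eps : within b tau -> b < b' < astar -> 0 <= t0 <= tau ->
  0 < eps -> exists delta, 0 < delta /\ forall t h, 0 <= t -> 0 <= h -> t + h <= tau ->
    Rabs (t - t0) < delta -> Rabs (t + h - t0) < delta ->
    nrm b' (vsub (vsub (sol (t + h)) (Sg h (sol t))) (vscal h (Z (sol t0)))) <= eps * h.
Proof.
  intros Hw Hb' Ht0 He. assert (Hb := proj1 Hw).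
  assert (Bb := Ban b ltac:(lra)). assert (Bb' := Ban b' ltac:(lra)).
  assert (Hincl : forall x, B b x -> B b' x) by (intros; apply (B_incl b); lra || easy).
  set (g := (b + b') / 2). assert (Hg : b < g < b') by (unfold g; lra).
  assert (Hgincl : forall x, B g x -> B b' x) by (intros; apply (B_incl g); lra || easy).
  set (z := Z (sol t0)). assert (Hs0 := sol_in b tau t0 Hw Ht0).
  assert (Hz : B g z) by (apply (Z_in b); lra || easy).
  assert (Hz0 := norm_ge0 _ _ _ (Ban g ltac:(lra)) z Hz).
  set (c := M astar / (b' - b) + N astar). assert (Hc : 0 < c) by (apply Z_const_pos; lra).
  set (G := growth 1). assert (HG : 1 <= G) by apply growth_ge1.
  destruct (Sg_lip0 g b' 1 ltac:(lra) ltac:(lra) ltac:(lra)) as [K1 [HK1 HK1b]].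
  destruct (sol_approx b tau Hw) as (K & q & Hq & HK).
  assert (HGc : 0 < G * c) by (apply Rmult_lt_0_compat; lra).
  destruct (sol_continuous b tau t0 (eps / 2 / (G * c)) Hw Ht0) as [d1 [Hd1 Hd1c]].
  { apply Rdiv_lt_0_compat; lra. }
  assert (HKz : 0 <= K1 * nrm g z) by now apply Rmult_le_pos.
  (* Both ends of the step lie within [d] of [t0], so times elapsed in it are at most [2 * d]: a
     quarter of [eps] becomes a half. The cap [1 / 2] keeps them below [1], where [G] and [K1] are
     valid, and [+ 1] guards against [z] being zero. *)
  set (d2 := eps / 4 / (K1 * nrm g z + 1)).
  assert (Hd2 : 0 < d2) by (apply Rdiv_lt_0_compat; lra).
  exists (Rmin d1 (Rmin d2 (1 / 2))). split; [repeat apply Rmin_pos; lra|].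
  intros t h Ht Hh Hth Htd Hthd.
  assert (Hm1 := Rmin_l d1 (Rmin d2 (1 / 2))). assert (Hm2 := Rmin_r d1 (Rmin d2 (1 / 2))).
  assert (Hm3 := Rmin_l d2 (1 / 2)). assert (Hm4 := Rmin_r d2 (1 / 2)).
  set (d := Rmin d1 (Rmin d2 (1 / 2))) in *.
  apply Rabs_def2 in Htd. apply Rabs_def2 in Hthd.
  assert (HSg : forall s x, s <= 1 -> B g x -> nrm b' (Sg s x) <= G * nrm b' x).
  { intros s x Hs Hx.
    apply Rle_trans with (1 := Sg_bound g b' s x ltac:(lra) ltac:(lra) ltac:(lra) Hx).
    apply Rmult_le_compat_r; [apply (norm_ge0 _ _ _ Bb'); auto|now apply growth_mono]. }
  assert (HZ : forall s x, s <= 1 -> B b x -> nrm b' (Sg s (Z x)) <= G * (c * nrm b x)).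
  { intros s x Hs Hx.
    apply Rle_trans with (1 := HSg s (Z x) Hs (Z_in b g x ltac:(lra) ltac:(lra) ltac:(lra) Hx)).
    apply Rmult_le_compat_l; [lra|]. apply Z_bound; lra || easy. }
  (* The three terms pay for replacing [sol] by iterates: in the integrand, at [t + h], and at [t]
     under [Sg h]. The last two involve the iterate [S k], hence the extra [q]. *)
  apply (le_geometric_limit _ _ (h * (G * c * K) + K * q + G * K * q) q Hq). intros k.
  assert (Hbb : als <= b' <= astar) by lra. assert (Hb1 : als < b' < astar) by lra.
  assert (Hpin : forall j r, B b (pic j r)) by (intros; now apply pic_in).
  assert (Hconv := good_conv _ (t + h) (good_Z _ (good_pic k))).
  set (I := vint (Ban b' Hbb) (fun r => Sg (t + h - r) (Z (pic k r))) t (t + h)).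
  assert (HI : B b' I) by apply vint_in.
  assert (HIz : nrm b' (vsub I (vscal (t + h - t) z)) <=
    (t + h - t) * (eps + G * c * K * q ^ k)).
  { apply vint_near_const.
    - intros r. exact (good_in _ b' r Hconv Hb1).
    - exact (good_continuous _ b' Hconv Hb1).
    - auto.
    - lra.
    - intros r Hr. set (s := t + h - r). assert (Hs : 0 <= s <= 2 * d) by (unfold s; lra).
      assert (Hrt : 0 <= r <= tau) by lra.
      destruct (HK k r Hrt) as [Hsr HKr].
      assert (Hx1 := ban_sub _ _ _ Bb _ _ (Hpin k r) Hsr).
      assert (Hx2 := ban_sub _ _ _ Bb _ _ Hsr Hs0).
      assert (HZg : forall x, B b x -> B g (Z x)) by (intros; apply (Z_in b); lra || easy).
      assert (HSZ : forall x, B b x -> B b' (Sg s (Z x)))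
        by (intros; apply Hgincl, Sg_in; auto; lra).
      assert (HSz : B b' (vsub (Sg s z) z))
        by (apply (ban_sub _ _ _ Bb'); [apply Hgincl, Sg_in; lra || easy|auto]).
      (* Error of the iterate, variation of [sol] between [r] and [t0], and motion of [z] under the
         semigroup. *)
      replace (vsub (Sg s (Z (pic k r))) z) with
        (vadd (vadd (Sg s (Z (vsub (pic k r) (sol r)))) (Sg s (Z (vsub (sol r) (sol t0)))))
          (vsub (Sg s z) z)).
      2:{ rewrite !(Z_sub b), !(Sg_sub g) by (auto; lra). fold z. vec. }
      assert (T1 := norm_add_le _ _ _ Bb' _ _
        (ban_add _ _ _ Bb' _ _ (HSZ _ Hx1) (HSZ _ Hx2)) HSz).
      assert (T2 := norm_add_le _ _ _ Bb' _ _ (HSZ _ Hx1) (HSZ _ Hx2)).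
      assert (T3 := HZ s _ ltac:(lra) Hx1). assert (T4 := HZ s _ ltac:(lra) Hx2).
      rewrite (norm_sub_sym _ _ _ Bb) in T3 by easy.
      assert (T5 : G * (c * nrm b (vsub (sol r) (pic k r))) <= G * (c * (K * q ^ k)))
        by (do 2 (apply Rmult_le_compat_l; [lra|]); easy).
      assert (T6 : G * (c * nrm b (vsub (sol r) (sol t0))) <= eps / 2).
      { assert (Hlt := Hd1c r Hrt ltac:(apply Rabs_def1; lra)).
        apply (Rmult_lt_compat_l (G * c)) in Hlt; [|easy].
        replace (G * c * (eps / 2 / (G * c))) with (eps / 2) in Hlt by (field; lra). lra. }
      assert (T7 := HK1b s z ltac:(lra) Hz).
      assert (T8 : K1 * s * nrm g z <= eps / 2).
      { replace (K1 * s * nrm g z) with (s * (K1 * nrm g z)) by ring.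
        apply Rle_trans with (2 * d2 * (K1 * nrm g z + 1)).
        - apply Rmult_le_compat; lra.
        - unfold d2. apply Req_le. field. lra. }
      lra. }
  replace (t + h - t) with h in HIz by ring.
  destruct (HK (S k) (t + h) ltac:(lra)) as [Hsth HKth].
  destruct (HK (S k) t ltac:(lra)) as [Hst HKt].
  assert (Hx3 := ban_sub _ _ _ Bb _ _ Hsth (Hpin (S k) (t + h))).
  assert (Hx4 := ban_sub _ _ _ Bb _ _ Hst (Hpin (S k) t)).
  assert (Hx4S : B b' (Sg h (vsub (sol t) (pic (S k) t)))) by (apply Hincl, Sg_in; lra || easy).
  assert (Hx5 : B b' (vsub I (vscal h z)))
    by (apply (ban_sub _ _ _ Bb'); [easy|apply (ban_scal _ _ _ Bb'); auto]).
  replace (vsub (vsub (sol (t + h)) (Sg h (sol t))) (vscal h z)) with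
    (vadd (vsub (vsub (sol (t + h)) (pic (S k) (t + h)))
      (Sg h (vsub (sol t) (pic (S k) t)))) (vsub I (vscal h z))).
  2:{ rewrite (pic_step k b' Hbb t h) by lra. fold I. rewrite (Sg_sub b) by (auto; lra). vec. }
  assert (T1 := norm_add_le _ _ _ Bb' _ _
    (ban_sub _ _ _ Bb' _ _ (Hincl _ Hx3) Hx4S) Hx5).
  assert (T2 := norm_sub_le _ _ _ Bb' _ _ (Hincl _ Hx3) Hx4S).
  assert (T3 := nrm_anti b b' _ ltac:(lra) ltac:(lra) ltac:(lra) Hx3).
  assert (T4 := Sg_bound b b' h _ ltac:(lra) ltac:(lra) ltac:(lra) Hx4).
  assert (T5 : growth h * nrm b' (vsub (sol t) (pic (S k) t)) <= G * (K * q ^ S k)).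
  { apply Rmult_le_compat.
    - assert (T := growth_ge1 h). lra.
    - apply (norm_ge0 _ _ _ Bb'). auto.
    - apply growth_mono. lra.
    - apply Rle_trans with (2 := HKt). apply nrm_anti; lra || easy. }
  change (q ^ S k) with (q * q ^ k) in HKth, T5. lra.
Qed.

(** [tau] is halfway from [t] to the lifetime, and [b - als] halfway from [m * tau] to
    [astar - als]. At each admissible time the solution thus lies strictly below [astar], which
    leaves room for [A] and [Z] to map it into [B astar]. *)
Lemma within_exists t : 0 <= t < Tdef nu M als astar ->
  exists b tau, t < tau /\ within b tau.
Proof.
  unfold Tdef. intros Ht. set (m := exp 1 * nu * M astar) in *.
  assert (Hm : 0 < m).
  { assert (H1 := exp_pos 1). assert (H2 := nu_ge1). assert (H3 := M_pos).
    unfold m. repeat apply Rmult_lt_0_compat; lra. }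
  set (T := (astar - als) / m) in *.
  assert (HT : m * T = astar - als) by (unfold T; field; lra).
  set (tau := (t + T) / 2).
  assert (Hx : m * tau < astar - als) by (rewrite <- HT; apply Rmult_lt_compat_l; unfold tau; lra).
  assert (Hx0 : 0 <= m * tau) by (apply Rmult_le_pos; unfold tau; lra).
  exists ((als + astar + m * tau) / 2), tau. unfold within. fold m.
  repeat split; unfold tau in *; lra.
Qed.

(** [Hkey] treats forward steps near [t0] only. For [h < 0] the increment is, up to sign, the
    forward step of length [- h] from [t0 + h], compared with the same [w]. *)
Lemma sol_deriv t0 : 0 < t0 < Tdef nu M als astar ->
  has_deriv_at (nrm astar) sol t0 (vadd (Aop (sol t0)) (Z (sol t0))).
Proof.
  intros Ht0 eps He.
  destruct (within_exists t0 ltac:(lra)) as (b & tau & Htau & Hw).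
  assert (Hb := proj1 Hw). set (b' := (b + astar) / 2).
  assert (Hb' : b < b' < astar) by (unfold b'; lra).
  assert (Bb := Ban b ltac:(lra)). assert (Bs := Ban astar ltac:(lra)).
  assert (Hincl : forall x, B b x -> B astar x) by (intros; apply (B_incl b); lra || easy).
  assert (Hs0 := sol_in b tau t0 Hw ltac:(lra)).
  assert (HA : B astar (Aop (sol t0))) by (apply (Aop_in b); lra || easy).
  assert (HZ' : B b' (Z (sol t0))) by (apply (Z_in b); lra || easy).
  assert (HZ : B astar (Z (sol t0))) by (apply (B_incl b'); lra || easy).
  destruct (sol_step b tau b' t0 (eps / 4) Hw Hb' ltac:(lra) ltac:(lra)) as [d1 [Hd1 Hstep]].
  destruct (Sg_deriv b (sol t0) (eps / 4) ltac:(lra) Hs0 ltac:(lra)) as [d2 [Hd2 Hder]].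
  destruct (Sg_lip0 b astar 1 ltac:(lra) ltac:(lra) ltac:(lra)) as [K [HK0 HK]].
  destruct (sol_continuous b tau t0 (eps / 4 / (K + 1)) Hw ltac:(lra)) as [d3 [Hd3 Hcont]].
  { apply Rdiv_lt_0_compat; lra. }
  set (w := vadd (Aop (sol t0)) (Z (sol t0))).
  assert (Hw' : B astar w) by now apply (ban_add _ _ _ Bs).
  assert (Hkey : forall t h, 0 <= t -> 0 < h <= 1 -> h < d2 -> t + h <= tau ->
    Rabs (t - t0) < d1 -> Rabs (t + h - t0) < d1 -> Rabs (t - t0) < d3 ->
    nrm astar (vsub (vsub (sol (t + h)) (sol t)) (vscal h w)) <= 3 / 4 * eps * h).
  { intros t h Ht Hh Hhd2 Hth H1 H2 H3.
    assert (Hst := sol_in b tau t Hw ltac:(lra)).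
    assert (Hsth := sol_in b tau (t + h) Hw ltac:(lra)).
    assert (Hdiff := ban_sub _ _ _ Bb _ _ Hst Hs0).
    assert (HSg : forall x, B b x -> B b (Sg h x)) by (intros; apply Sg_in; lra || easy).
    (* [x1] is the one-step remainder, [x2] corrects for starting the semigroup at [sol t] instead
       of [sol t0], and [x3] is the generator's remainder at [sol t0]. Each costs at most
       [eps / 4 * h], so the final inequality is strict. *)
    set (x1 := vsub (vsub (sol (t + h)) (Sg h (sol t))) (vscal h (Z (sol t0)))).
    set (y := vsub (sol t) (sol t0)) in *.
    set (x2 := vsub (Sg h y) y).
    set (x3 := vsub (vsub (Sg h (sol t0)) (sol t0)) (vscal h (Aop (sol t0)))).
    assert (Hx1' : B b' x1).
    { assert (Bb' := Ban b' ltac:(lra)). unfold x1.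
      apply (ban_sub _ _ _ Bb'); [|now apply (ban_scal _ _ _ Bb')].
      apply (B_incl b); try lra. apply (ban_sub _ _ _ Bb); auto. }
    assert (Hx1 : B astar x1) by (apply (B_incl b'); lra || easy).
    assert (Hx2 : B astar x2) by (apply Hincl, (ban_sub _ _ _ Bb); auto).
    assert (Hx3 : B astar x3).
    { apply (ban_sub _ _ _ Bs); [|now apply (ban_scal _ _ _ Bs)].
      apply Hincl, (ban_sub _ _ _ Bb); auto. }
    replace (vsub (vsub (sol (t + h)) (sol t)) (vscal h w)) with (vadd (vadd x1 x2) x3).
    2:{ unfold x1, x2, x3, w, y. rewrite (Sg_sub b) by (lra || easy). vec. }
    assert (T1 := norm_add_le _ _ _ Bs _ _ (ban_add _ _ _ Bs _ _ Hx1 Hx2) Hx3).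
    assert (T2 := norm_add_le _ _ _ Bs _ _ Hx1 Hx2).
    assert (T3 := nrm_anti b' astar x1 ltac:(lra) ltac:(lra) ltac:(lra) Hx1').
    assert (T4 := Hstep t h Ht ltac:(lra) Hth H1 H2). fold x1 in T4.
    assert (T5 := Hder h ltac:(lra)). fold x3 in T5.
    assert (T6 := HK h y ltac:(lra) Hdiff). fold x2 in T6.
    assert (T7 : K * h * nrm b y <= eps / 4 * h).
    { assert (Hlt := Hcont t ltac:(lra) H3). fold y in Hlt.
      assert (Hy0 := norm_ge0 _ _ _ Bb y Hdiff).
      apply (Rmult_lt_compat_l (K + 1)) in Hlt; [|lra].
      replace ((K + 1) * (eps / 4 / (K + 1))) with (eps / 4) in Hlt by (field; lra).
      replace (K * h * nrm b y) with (K * nrm b y * h) by ring.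
      apply Rmult_le_compat_r; lra. }
    lra. }
  set (d := Rmin (Rmin d1 (Rmin d2 d3)) (Rmin (Rmin t0 (tau - t0)) 1)).
  exists d. split; [unfold d; repeat apply Rmin_pos; lra|].
  intros h Hh0 Hhd.
  assert (Hd : d <= d1 /\ d <= d2 /\ d <= d3 /\ d <= t0 /\ d <= tau - t0 /\ d <= 1).
  { unfold d, Rmin. repeat destruct (Rle_dec _ _); lra. }
  set (X := vsub (vsub (sol (t0 + h)) (sol t0)) (vscal h w)).
  assert (HX : B astar X /\ nrm astar X <= 3 / 4 * eps * Rabs h).
  { assert (Hsh : B astar (sol (t0 + h))).
    { apply Hincl, (sol_in b tau); [easy|]. apply Rabs_def2 in Hhd. lra. }
    split.
    { repeat apply (ban_sub _ _ _ Bs); auto. now apply (ban_scal _ _ _ Bs). }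
    destruct (Rlt_le_dec h 0) as [Hneg|Hpos].
    - rewrite Rabs_left in * by easy.
      assert (T := Hkey (t0 + h) (- h) ltac:(lra) ltac:(lra) ltac:(lra) ltac:(lra)).
      replace (t0 + h + - h) with t0 in T by ring.
      replace (t0 + h - t0) with h in T by ring.
      replace (t0 - t0) with 0 in T by ring. rewrite Rabs_R0, Rabs_left in T by easy.
      replace X with (vopp (vsub (vsub (sol t0) (sol (t0 + h))) (vscal (- h) w)))
        by (unfold X; vec).
      rewrite (norm_opp_eq _ _ _ Bs).
      + apply T; lra.
      + repeat apply (ban_sub _ _ _ Bs); auto. now apply (ban_scal _ _ _ Bs).
    - rewrite Rabs_pos_eq in * by easy.
      assert (T := Hkey t0 h ltac:(lra) ltac:(lra) ltac:(lra) ltac:(lra)).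
      replace (t0 + h - t0) with h in T by ring.
      replace (t0 - t0) with 0 in T by ring.
      rewrite Rabs_R0, Rabs_pos_eq in T by easy. apply T; lra. }
  destruct HX as [HXi HXn].
  replace (vsub (vscal (/ h) (vsub (sol (t0 + h)) (sol t0))) w) with (vscal (/ h) X)
    by (unfold X; vec_coef; field; easy).
  rewrite (norm_scal_eq _ _ _ Bs), Rabs_inv by easy.
  assert (Hah : 0 < Rabs h) by now apply Rabs_pos_lt.
  apply Rmult_lt_reg_l with (Rabs h); [easy|].
  replace (Rabs h * (/ Rabs h * nrm astar X)) with (nrm astar X) by (field; lra). nra.
Qed.

(** [A] and [Z] are linear and bounded from [B b] to [B astar], and [sol] is continuous already in
    [B b]. *)
Lemma rhs_continuous t0 eps : 0 < t0 < Tdef nu M als astar -> 0 < eps ->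
  exists delta, 0 < delta /\ forall t, 0 < t -> Rabs (t - t0) < delta ->
    nrm astar (vsub (vadd (Aop (sol t)) (Z (sol t))) (vadd (Aop (sol t0)) (Z (sol t0))))
      < eps.
Proof.
  intros Ht0 He. destruct (within_exists t0 ltac:(lra)) as (b & tau & Htau & Hw).
  assert (Hb := proj1 Hw).
  assert (Bb := Ban b ltac:(lra)). assert (Bs := Ban astar ltac:(lra)).
  destruct (Aop_bound b ltac:(lra)) as [K [HK0 HK]].
  set (c := M astar / (astar - b) + N astar).
  assert (Hc : 0 < c) by (apply Z_const_pos; lra).
  destruct (sol_continuous b tau t0 (eps / (K + c)) Hw ltac:(lra)) as [d [Hd Hcont]].
  { apply Rdiv_lt_0_compat; lra. }
  exists (Rmin d (tau - t0)). split; [apply Rmin_pos; lra|].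
  intros t Ht Htd.
  assert (Hm1 := Rmin_l d (tau - t0)). assert (Hm2 := Rmin_r d (tau - t0)).
  assert (Htd' := Rabs_def2 _ _ Htd).
  assert (Hlt := Hcont t ltac:(lra) ltac:(lra)).
  assert (Hs := sol_in b tau t Hw ltac:(lra)). assert (Hs0 := sol_in b tau t0 Hw ltac:(lra)).
  assert (Hy := ban_sub _ _ _ Bb _ _ Hs Hs0).
  replace (vsub (vadd (Aop (sol t)) (Z (sol t))) (vadd (Aop (sol t0)) (Z (sol t0)))) with
    (vadd (Aop (vsub (sol t) (sol t0))) (Z (vsub (sol t) (sol t0)))).
  2:{ rewrite (Aop_sub b), (Z_sub b) by (lra || easy). vec. }
  set (y := vsub (sol t) (sol t0)) in *.
  assert (T := norm_add_le _ _ _ Bs _ _ (Aop_in b y ltac:(lra) Hy)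
    (Z_in b astar y ltac:(lra) ltac:(lra) ltac:(lra) Hy)).
  assert (T1 := HK y Hy).
  assert (T2 := Z_bound b astar y ltac:(lra) ltac:(lra) ltac:(lra) Hy). fold c in T2.
  apply (Rmult_lt_compat_l (K + c)) in Hlt; [|lra].
  replace ((K + c) * (eps / (K + c))) with eps in Hlt by (field; lra). lra.
Qed.

Lemma autonomous_solution : let T := Tdef nu M als astar in exists v : R -> V,
  v 0 = us /\
  (forall t, 0 <= t < T -> B astar (v t)) /\
  cont_on (nrm astar) (fun t => 0 <= t < T) v /\
  (forall t, 0 < t < T -> B astar (Aop (v t)) /\ B astar (Z (v t)) /\
    has_deriv_at (nrm astar) v t (vadd (Aop (v t)) (Z (v t)))) /\
  cont_on (nrm astar) (fun t => 0 < t < T) (fun t => vadd (Aop (v t)) (Z (v t))).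
Proof.
  intros T. exists sol. split; [exact sol_0|]. split; [|split; [|split]].
  - intros t Ht. destruct (within_exists t Ht) as (b & tau & Htau & Hw).
    assert (Hb := proj1 Hw). apply (B_incl b); try lra. apply (sol_in b tau); [easy|lra].
  - intros t0 Ht0 eps He. destruct (within_exists t0 Ht0) as (b & tau & Htau & Hw).
    assert (Hb := proj1 Hw).
    destruct (sol_continuous b tau t0 eps Hw ltac:(lra) He) as [d [Hd Hcont]].
    exists (Rmin d (tau - t0)). split; [apply Rmin_pos; lra|]. intros t Ht Htd.
    assert (Hm1 := Rmin_l d (tau - t0)). assert (Hm2 := Rmin_r d (tau - t0)).
    assert (Htd' := Rabs_def2 _ _ Htd). assert (Htau' : 0 <= t <= tau) by lra.
    apply Rle_lt_trans with (2 := Hcont t Htau' ltac:(lra)).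
    apply nrm_anti; try lra. apply (ban_sub _ _ _ (Ban b ltac:(lra)));
      apply (sol_in b tau); easy || lra.
  - intros t Ht. assert (Ht' : 0 <= t < T) by lra.
    destruct (within_exists t Ht') as (b & tau & Htau & Hw).
    assert (Hb := proj1 Hw). assert (Hin := sol_in b tau t Hw ltac:(lra)).
    split; [|split].
    + apply (Aop_in b); easy || lra.
    + apply (Z_in b); easy || lra.
    + now apply sol_deriv.
  - intros t0 Ht0 eps He. destruct (rhs_continuous t0 eps Ht0 He) as [d [Hd H]].
    exists d. split; [easy|]. intros t Ht. now apply H.
Qed.

End Scale.

Theorem theorem1 (V : VSpace) (alo : R) (ahi : option R)
  (B : R -> V -> Prop) (nrm : R -> V -> R) (C D : R -> V -> Prop)
  (Aop : V -> V) (S : R -> R -> V -> V) (nu omega : R)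
  (M N : R -> R) (Z : V -> V)
  (HA1 : StdA1 alo ahi B nrm)
  (HA2 : StdA2 alo ahi B nrm C D Aop S nu omega)
  (HA3 : StdA3 alo ahi B nrm M N Z)
  (astar s als : R) (us : V)
  (Hastar : inI alo ahi astar) (Hs : 0 <= s)
  (Hals : alo < als < astar) (Hus : B als us) :
  let T := Tdef nu M als astar in
  exists (u du : R -> V),
    (forall t, s <= t < s + T -> B astar (u t)) /\
    cont_on (nrm astar) (fun t => s <= t < s + T) u /\
    (forall t, s < t < s + T -> B astar (du t) /\ has_deriv_at (nrm astar) u t (du t)) /\
    cont_on (nrm astar) (fun t => s < t < s + T) du /\
    (forall t, s < t < s + T ->
       B astar (Aop (u t)) /\ B astar (Z (u t)) /\
       du t = vadd (Aop (u t)) (Z (u t))) /\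
    u s = us.
Proof.
  intros T.
  destruct (autonomous_solution V alo ahi B nrm C D Aop S nu omega M N Z HA1 HA2 HA3
    astar als us Hastar Hals Hus) as (v & Hv0 & Hvin & Hvcont & Hv & Hrhs).
  fold T in Hvin, Hvcont, Hv, Hrhs.
  (* The equation is autonomous, so a time shift moves the initial time from zero to [s]. *)
  exists (fun t => v (t - s)), (fun t => vadd (Aop (v (t - s))) (Z (v (t - s)))).
  split; [|split; [|split; [|split; [|split]]]].
  - intros t Ht. apply Hvin. lra.
  - intros t0 Ht0 eps He.
    destruct (Hvcont (t0 - s) ltac:(lra) eps He) as [d [Hd H]].
    exists d. split; [easy|]. intros t Ht Htd. apply H; [lra|].
    now replace (t - s - (t0 - s)) with (t - t0) by ring.
  - intros t Ht. destruct (Hv (t - s) ltac:(lra)) as (HA & HZ & Hder). split.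
    + now apply HA1.
    + intros eps He. destruct (Hder eps He) as [d [Hd H]].
      exists d. split; [easy|]. intros h Hh Hhd.
      replace (t + h - s) with (t - s + h) by ring. now apply H.
  - intros t0 Ht0 eps He.
    destruct (Hrhs (t0 - s) ltac:(lra) eps He) as [d [Hd H]].
    exists d. split; [easy|]. intros t Ht Htd. apply (H (t - s)); [lra|].
    now replace (t - s - (t0 - s)) with (t - t0) by ring.
  - intros t Ht. destruct (Hv (t - s) ltac:(lra)) as (HA & HZ & _). now split.
  - cbv beta. now replace (s - s) with 0 by ring.
Qed.
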